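(* Let $p(n)$ denote the number of partitions of $n$ and let $q(n)=p(n)/n$ for $n\ge 1$. Then the sequence $\{q(n)\}_{n\ge 31}$ is log-concave, i.e., $q(n)^2 \ge q(n-1)\,q(n+1)$ for all integers $n\ge 32$.
   Context: $p(n)$ is the partition function: the number of ways of writing $n$ as an unordered sum of positive integers. A sequence $(a_n)$ is log-concave if $a_n^2-a_{n-1}a_{n+1}\ge 0$ for all admissible $n$. *)

(* Defs.v *)
From mathcomp Require Import all_boot all_algebra.
Set Implicit Arguments. Unset Strict Implicit. Unset Printing Implicit Defensive.
Import GRing.Theory Num.Theory.

(* A partition of n is an unordered sum of positive integers equal to n,
   recorded by its multiplicity function: f i = number of parts equal to i+1
   (parts are in 1..n, each multiplicity is at most n). *)
Definition partition_count (n : nat) : nat :=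
  #|[set f : {ffun 'I_n -> 'I_n.+1} | \sum_(i < n) (i.+1 * f i) == n]|.

Definition q (n : nat) : rat := (partition_count n)%:R / n%:R.

(* Main.v *)
Require Import Defs.
From Stdlib Require Import Ranalysis5 Reals Lra Lia Psatz ZArith NArith.
From Coquelicot Require Import Coquelicot.

(** Fix [n] and write [P(x)] for the product of [1/(1 - x^k)].  By the AM-GM inequality
    [p(n-1) p(n+1) <= ((e^a p(n-1) + e^{-a} p(n+1)) / 2)^2], so it suffices to find [a > 0] with
    [(e^a p(n-1) + e^{-a} p(n+1)) / 2 <= (1 - 0.6/n^2) p(n)].  Writing the coefficients of [P] as Fourier
    integrals over the circle of radius [e^{-a}], this says that the integral over [0 <= t <= pi] of
    [Re (P(e^{-a+it}) e^{-int}) (1 - cos t - 0.6/n^2)] is nonnegative.  Choose [a] so that the phase of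
    [P(e^{-a+it}) e^{-int}] has no linear term.  Then, in units of the standard deviation [a^{3/2}], the
    phase is [O(a^{1/2} t^3)] and the modulus is close to a Gaussian, which gives an explicit positive lower
    bound for the part of the integral with [t <= a^{3/2}]; up to [t = 1.71 a^{3/2}] the integrand is
    nonnegative, and beyond that the modulus is small enough to be negligible.  The factor [1 - cos t] makes
    constant-factor estimates sufficient, so no modular transformation is needed: only the terms [m = 1, 2] of
    [log |P|] as a sum over powers [x^{km}/m] enter.  Everything works for [n >= 2000], i.e. [a <= 0.029];
    smaller [n] are checked by computing the partition numbers. *)

Local Open Scope R_scope.

(** * Elementary inequalities *)

(** Clearing denominators turns the claim into [n^2 p(n-1) p(n+1) <= (n^2 - 1) p(n)^2], because
    [(n-1)(n+1) = n^2 - 1]; this is why a gain of [0.6/n^2] after AM-GM is aimed at. There is room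
    for it: [n] has order [a^{-2}], so [0.6/n^2] has order [a^4], while on the scale [t ~ a^{3/2}]
    the weight [1 - cos t] has order [a^3]. The infinite product is never formed. It is cut at
    [K = (n+1)^4] factors, which leaves the coefficients up to [n+1] unchanged and makes the
    truncation errors negligible. Its Fourier coefficients are identified by a recursion in [K]
    alone, without power series or complex numbers: modulus and argument of each factor are carried
    separately. All pieces of the integral are measured against [amp a K 0 * a^{9/2}]. Half-integer
    powers of [a] are avoided by writing [a = b^2], so that the standard-deviation scale is [b^3]
    and the unit is [b^9]. *)

Lemma derive_nonneg_incr (f df : R -> R) (x y : R) :
  x <= y ->
  (forall t, x <= t <= y -> is_derive f t (df t)) ->
  (forall t, x <= t <= y -> 0 <= df t) -> f x <= f y.
Proof.
intros Hxy Hd Hp.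
destruct (MVT_gen f x y df) as [c [Hc E]].
- intros t; rewrite Rmin_left, Rmax_right by lra; intros; apply Hd; lra.
- intros t; rewrite Rmin_left, Rmax_right by lra; intros.
  apply derivable_continuous_pt; exists (df t); apply is_derive_Reals, Hd; lra.
- rewrite Rmin_left, Rmax_right in Hc by lra.
  specialize (Hp c Hc); nra.
Qed.

(** Every piece of the main integral is bounded this way: only a minorant with a known primitive is
    needed, so the tail may use a primitive designed first, with the minorant read off as its
    derivative. *)
Lemma RInt_ge_primitive (f H h : R -> R) (x y : R) :
  x <= y ->
  (forall t, continuous f t) ->
  (forall t, x <= t <= y -> is_derive H t (h t)) ->
  (forall t, x <= t <= y -> h t <= f t) -> H y - H x <= RInt f x y.
Proof.
intros Hxy Hc Hd Hle.
assert (Hi : forall u v, ex_RInt f u v).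
{ intros u v; apply (ex_RInt_continuous (V := R_CompleteNormedModule)); intros; apply Hc. }
assert (E : RInt f x x - H x <= RInt f x y - H y).
{ apply (derive_nonneg_incr (fun t => RInt f x t - H t) (fun t => f t - h t)); auto.
  - intros t Ht.
    apply (is_derive_minus (fun t => RInt f x t) H t).
    + apply (is_derive_RInt f _ x t).
      * exists (mkposreal 1 Rlt_0_1); intros z _; apply (RInt_correct (V := R_CompleteNormedModule)), Hi.
      * apply Hc.
    + now apply Hd.
  - intros t Ht; specialize (Hle t Ht); lra. }
rewrite RInt_point in E; unfold zero in E; simpl in E; lra.
Qed.

(** From here to [exp_neg_ge_3] the Taylor bounds climb one degree at a time: differentiating the
    difference of the two sides leaves the bound of the previous degree. *)
Lemma cos_ge_2 (x : R) : 1 - x ^ 2 / 2 <= cos x.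
Proof.
assert (P : forall x, 0 <= x -> 1 - x ^ 2 / 2 <= cos x).
{ intros y Hy.
  assert (E : cos 0 - (1 - 0 ^ 2 / 2) <= cos y - (1 - y ^ 2 / 2)).
  { apply (derive_nonneg_incr (fun t => cos t - (1 - t ^ 2 / 2)) (fun t => t - sin t)); auto.
    - intros t _; auto_derive; [easy | field].
    - intros t Ht.
      destruct (Req_dec t 0) as [-> | Ht0]; [rewrite sin_0; lra|].
      assert (sin t < t) by (apply sin_lt_x; lra); lra. }
  rewrite cos_0 in E; lra. }
destruct (Rle_dec 0 x); [now apply P|].
rewrite <- cos_neg; specialize (P (- x)); nra.
Qed.

Lemma sin_ge_3 (x : R) : 0 <= x -> x - x ^ 3 / 6 <= sin x.
Proof.
intros Hx.
assert (E : sin 0 - (0 - 0 ^ 3 / 6) <= sin x - (x - x ^ 3 / 6)).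
{ apply (derive_nonneg_incr (fun t => sin t - (t - t ^ 3 / 6)) (fun t => cos t - (1 - t ^ 2 / 2))); auto.
  - intros t _; auto_derive; [easy | field].
  - intros t _; generalize (cos_ge_2 t); lra. }
rewrite sin_0 in E; lra.
Qed.

Lemma cos_le_4 (x : R) : 0 <= x -> cos x <= 1 - x ^ 2 / 2 + x ^ 4 / 24.
Proof.
intros Hx.
assert (E : (1 - 0 ^ 2 / 2 + 0 ^ 4 / 24) - cos 0 <= (1 - x ^ 2 / 2 + x ^ 4 / 24) - cos x).
{ apply (derive_nonneg_incr (fun t => (1 - t ^ 2 / 2 + t ^ 4 / 24) - cos t)
    (fun t => sin t - (t - t ^ 3 / 6))); auto.
  - intros t _; auto_derive; [easy | field].
  - intros t Ht; generalize (sin_ge_3 t); lra. }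
rewrite cos_0 in E; lra.
Qed.

Lemma exp_neg_ge_3 (x : R) : 0 <= x -> 1 - x + x ^ 2 / 2 - x ^ 3 / 6 <= exp (- x).
Proof.
intros Hx.
assert (P1 : forall y, 0 <= y -> exp (- y) <= 1 - y + y ^ 2 / 2).
{ intros y Hy.
  assert (E : (1 - 0 + 0 ^ 2 / 2) - exp (- 0) <= (1 - y + y ^ 2 / 2) - exp (- y)).
  { apply (derive_nonneg_incr (fun t => (1 - t + t ^ 2 / 2) - exp (- t))
      (fun t => exp (- t) - (1 + - t))); auto.
    - intros t _; auto_derive; [easy | field].
    - intros t _; generalize (exp_ineq1_le (- t)); lra. }
  rewrite Ropp_0, exp_0 in E; lra. }
assert (E : exp (- 0) - (1 - 0 + 0 ^ 2 / 2 - 0 ^ 3 / 6) <= exp (- x) - (1 - x + x ^ 2 / 2 - x ^ 3 / 6)).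
{ apply (derive_nonneg_incr (fun t => exp (- t) - (1 - t + t ^ 2 / 2 - t ^ 3 / 6))
    (fun t => (1 - t + t ^ 2 / 2) - exp (- t))); auto.
  - intros t _; auto_derive; [easy | field].
  - intros t Ht; generalize (P1 t); lra. }
rewrite Ropp_0, exp_0 in E; lra.
Qed.

Lemma exp_ge_4 (x : R) : 0 <= x -> 1 + x + x ^ 2 / 2 + x ^ 3 / 6 + x ^ 4 / 24 <= exp x.
Proof.
intros Hx; generalize (exp_ge_taylor x 4 Hx); simpl; lra.
Qed.

Lemma geo_le_inv (y : R) : 0 < y -> exp (- y) / (1 - exp (- y)) <= / y.
Proof.
intros Hy.
assert (H1 : exp (- y) < 1) by (rewrite <- exp_0; apply exp_increasing; lra).
assert (E : exp (- y) * exp y = 1) by (rewrite <- exp_plus, Rplus_opp_l; apply exp_0).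
generalize (exp_ineq1_le y) (exp_pos (- y)); intros H2 H3.
apply Rmult_le_reg_r with (y * (1 - exp (- y))); [nra|].
field_simplify; [nra | lra | lra].
Qed.

(* [2 sinh (y/2) >= y], squared. *)
Lemma geo_sq_le_inv (y : R) : 0 < y -> exp (- y) / (1 - exp (- y)) ^ 2 <= / y ^ 2.
Proof.
intros Hy.
assert (H1 : exp (- y) < 1) by (rewrite <- exp_0; apply exp_increasing; lra).
assert (S : forall z, 0 <= z -> 2 * z <= exp z - exp (- z)).
{ intros z Hz.
  assert (E : exp 0 - exp (- 0) - 2 * 0 <= exp z - exp (- z) - 2 * z).
  { apply (derive_nonneg_incr (fun t => exp t - exp (- t) - 2 * t)
      (fun t => exp t + exp (- t) - 2)); auto.
    - intros t _; auto_derive; [easy | ring].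
    - intros t _.
      assert (H : exp t * exp (- t) = 1) by (rewrite <- exp_plus, Rplus_opp_r; apply exp_0).
      assert (0 <= exp (- t) * (exp t - 1) ^ 2)
        by (apply Rmult_le_pos; [left; apply exp_pos | apply pow2_ge_0]).
      replace (exp (- t) * (exp t - 1) ^ 2)
        with (exp t * (exp t * exp (- t)) - 2 * (exp t * exp (- t)) + exp (- t)) in * by ring.
      rewrite H in *; lra. }
  rewrite Ropp_0 in E; lra. }
specialize (S (y / 2)).
set (p := exp (y / 2)) in *; set (q := exp (- (y / 2))) in *.
assert (E1 : p * q = 1) by (unfold p, q; rewrite <- exp_plus, Rplus_opp_r; apply exp_0).
assert (E2 : exp (- y) = q * q) by (unfold q; rewrite <- exp_plus; f_equal; field).
assert (0 < q) by apply exp_pos.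
rewrite E2 in *.
assert (y * q <= 1 - q * q) by nra.
apply Rmult_le_reg_r with (y ^ 2 * (1 - q * q) ^ 2).
{ apply Rmult_lt_0_compat; apply pow_lt; lra. }
field_simplify; [|lra|lra].
assert ((y * q) ^ 2 <= (1 - q * q) ^ 2) by (apply pow_incr; nra).
nra.
Qed.

(* [tanh (y/2) <= y/2]. *)
Lemma coth_half_ge (y : R) : 0 < y -> 2 / y <= (1 + exp (- y)) / (1 - exp (- y)).
Proof.
intros Hy.
assert (H1 : exp (- y) < 1) by (rewrite <- exp_0; apply exp_increasing; lra).
assert (E : 0 * (1 + exp (- 0)) - 2 * (1 - exp (- 0)) <= y * (1 + exp (- y)) - 2 * (1 - exp (- y))).
{ apply (derive_nonneg_incr (fun t => t * (1 + exp (- t)) - 2 * (1 - exp (- t)))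
    (fun t => 1 - exp (- t) * (1 + t))); [lra| |].
  - intros t _; auto_derive; [easy | ring].
  - intros t Ht.
    assert (exp t * exp (- t) = 1) by (rewrite <- exp_plus, Rplus_opp_r; apply exp_0).
    generalize (exp_pos (- t)) (exp_ineq1_le t); nra. }
rewrite Ropp_0, exp_0 in E.
apply Rmult_le_reg_r with (y * (1 - exp (- y))); [nra|].
field_simplify; [nra | lra | lra].
Qed.

Lemma exp_neg_lt_1 (y : R) : 0 < y -> 0 < exp (- y) < 1.
Proof. intros; split; [apply exp_pos|]; rewrite <- exp_0; apply exp_increasing; lra. Qed.

Lemma one_sub_exp_bounds (y : R) : 0 < y -> y * (1 - y / 2) <= 1 - exp (- y) <= y.
Proof.
intros Hy; split.
- assert (E : (1 - exp (- 0)) - 0 * (1 - 0 / 2) <= (1 - exp (- y)) - y * (1 - y / 2)).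
  { apply (derive_nonneg_incr (fun t => (1 - exp (- t)) - t * (1 - t / 2))
      (fun t => exp (- t) - (1 + - t))); [lra| |].
    - intros t _; auto_derive; [easy | field].
    - intros t _; generalize (exp_ineq1_le (- t)); lra. }
  rewrite Ropp_0, exp_0 in E; lra.
- generalize (exp_ineq1_le (- y)); lra.
Qed.

(** * One factor of the product *)

Definition den (r x : R) : R := 1 - 2 * r * cos x + r ^ 2.
Definition arg1 (r x : R) : R := atan (r * sin x / (1 - r * cos x)).

Lemma den_eq (r x : R) : den r x = (1 - r) ^ 2 + 2 * r * (1 - cos x).
Proof. unfold den; ring. Qed.

Lemma den_ge (r x : R) : 0 <= r -> (1 - r) ^ 2 <= den r x.
Proof. intros; rewrite den_eq; generalize (COS_bound x); nra. Qed.

Lemma den_pos (r x : R) : 0 <= r < 1 -> 0 < den r x.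
Proof. intros; generalize (den_ge r x); nra. Qed.

Lemma one_sub_rcos_pos (r x : R) : 0 <= r < 1 -> 0 < 1 - r * cos x.
Proof. intros; generalize (COS_bound x); nra. Qed.

(* [1 - r e^{ix} = sqrt (den r x) * e^{- i arg1 r x}]. *)
Lemma polar (r x : R) : 0 <= r < 1 ->
  sqrt (den r x) * cos (arg1 r x) = 1 - r * cos x /\
  sqrt (den r x) * sin (arg1 r x) = r * sin x.
Proof.
intros Hr; generalize (one_sub_rcos_pos r x Hr) (den_pos r x Hr); intros H1 H2.
set (u := r * sin x / (1 - r * cos x)).
assert (E : 1 + u² = den r x / (1 - r * cos x)²).
{ unfold u, den, Rsqr; generalize (sin2_cos2 x); unfold Rsqr; intros S.
  field_simplify_eq; [|lra].
  replace (r ^ 2 * sin x ^ 2) with (r ^ 2 * (sin x * sin x)) by ring.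
  replace (sin x * sin x) with (1 - cos x * cos x) by lra; ring. }
assert (H3 : 0 < sqrt (den r x)) by now apply sqrt_lt_R0.
assert (E2 : sqrt (1 + u²) = sqrt (den r x) / (1 - r * cos x)).
{ rewrite E, sqrt_div_alt by (apply Rmult_lt_0_compat; lra).
  rewrite sqrt_Rsqr; lra. }
unfold arg1; fold u; rewrite cos_atan, sin_atan, E2; split.
- field; lra.
- unfold u; field; lra.
Qed.

(** In [ln (den r x) = 2 ln (1 - r) + 2 sum_m r^m (1 - cos (m x)) / m] all terms of the sum are
    nonnegative; the terms [m = 1, 2] are kept. The series is avoided by showing that the difference
    of logarithms increases in the radius. *)
Lemma den_ge_exp (r x : R) : 0 <= r < 1 ->
  (1 - r) ^ 2 * exp (2 * (r * (1 - cos x) + r ^ 2 * (1 - cos (2 * x)) / 2)) <= den r x.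
Proof.
intros Hr.
replace (cos (2 * x)) with (2 * cos x * cos x - 1) by (rewrite cos_2a_cos; ring).
generalize (COS_bound x); unfold den; set (c := cos x); intros Hc.
assert (P : forall s, 0 <= s < 1 -> 0 < 1 - 2 * s * c + s ^ 2) by (intros; nra).
set (g := fun s => ln (1 - 2 * s * c + s ^ 2) - 2 * ln (1 - s)
                   - 2 * (s * (1 - c) + s ^ 2 * (1 - (2 * c * c - 1)) / 2)).
assert (E : g 0 <= g r).
{ apply (derive_nonneg_incr g (fun s => (2 * s - 2 * c) / (1 - 2 * s * c + s ^ 2) + 2 / (1 - s)
      - 2 * (1 - c) - 4 * s * (1 - c * c))); [lra| |].
  - intros s Hs; unfold g; specialize (P s); auto_derive.
    + split; [lra|]; split; [lra|easy].
    + field; split; [lra|]; apply Rgt_not_eq; lra.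
  - intros s Hs; specialize (P s).
    assert (0 < 1 - 2 * s * c + s ^ 2) by (apply P; lra); clear P.
    replace (_ - _) with (2 * (1 - c) / ((1 - s) * (1 - 2 * s * c + s ^ 2)) *
      ((1 + s) - (1 - s) * (1 - 2 * s * c + s ^ 2) * (1 + 2 * s * (1 + c)))) by (field; lra).
    apply Rmult_le_pos.
    + apply Rdiv_le_0_compat; [lra|]; apply Rmult_lt_0_compat; lra.
    (* With [w = 2 s e] the denominator is [(1 + s)^2 - w], so its product with [1 + w] is quadratic
       in [w]. Completing the square leaves a polynomial in [s] with nonnegative coefficients plus
       [(1 - s) q]. *)
    + set (e := 1 + c).
      replace c with (e - 1) by (unfold e; ring).
      rewrite Rmult_assoc.
      replace ((1 - 2 * s * (e - 1) + s ^ 2) * (1 + 2 * s * e)) with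
        ((1 + s) ^ 2 + s ^ 2 * (2 + s) ^ 2 / 4 - (2 * s * e - (2 * s + s ^ 2) / 2) ^ 2) by field.
      generalize (pow2_ge_0 (2 * s * e - (2 * s + s ^ 2) / 2)).
      set (q := (2 * s * e - (2 * s + s ^ 2) / 2) ^ 2); intros Hq.
      assert (0 <= s ^ 3) by (apply pow_le; lra).
      assert (0 <= s ^ 4) by (apply pow_le; lra).
      assert (0 <= s ^ 5) by (apply pow_le; lra).
      replace (1 + s - _) with (s ^ 3 + 3 / 4 * s ^ 4 + s ^ 5 / 4 + (1 - s) * q) by field.
      nra. }
unfold g in E.
replace (1 - 2 * 0 * c + 0 ^ 2) with 1 in E by ring.
rewrite Rminus_0_r, ln_1 in E.
set (X := 2 * (r * (1 - c) + r ^ 2 * (1 - (2 * c * c - 1)) / 2)) in *.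
replace ((1 - r) ^ 2) with (exp (2 * ln (1 - r))).
2:{ replace (2 * ln (1 - r)) with (ln (1 - r) + ln (1 - r)) by ring.
    rewrite exp_plus, exp_ln by lra; ring. }
rewrite <- exp_plus, <- (exp_ln (1 - 2 * r * c + r ^ 2)) by (apply P; lra).
destruct (Rle_lt_or_eq_dec (2 * ln (1 - r) + X) (ln (1 - 2 * r * c + r ^ 2))) as [L|L]; [lra| |].
- left; now apply exp_increasing.
- now rewrite L; right.
Qed.

(** Uses [2 (1 - cos x) <= x^2] and [1 + u <= e^u]. The coefficient [r / (1 - r)^2] is the variance
    of the geometric law, so the product over [k] is compared with a Gaussian. *)
Lemma den_le_exp (r x : R) : 0 <= r < 1 ->
  den r x <= (1 - r) ^ 2 * exp (r / (1 - r) ^ 2 * x ^ 2).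
Proof.
intros Hr; rewrite den_eq.
generalize (cos_ge_2 x) (exp_ineq1_le (r / (1 - r) ^ 2 * x ^ 2)); intros Hc He.
assert (H0 : 0 < (1 - r) ^ 2) by (apply pow_lt; lra).
apply Rle_trans with ((1 - r) ^ 2 * (1 + r / (1 - r) ^ 2 * x ^ 2)).
- rewrite Rmult_plus_distr_l, Rmult_1_r.
  replace ((1 - r) ^ 2 * (r / (1 - r) ^ 2 * x ^ 2)) with (r * x ^ 2) by (field; lra).
  nra.
- apply Rmult_le_compat_l; lra.
Qed.

Lemma is_derive_arg1 (r x : R) : 0 <= r < 1 ->
  is_derive (fun t => arg1 r t) x ((r * cos x - r ^ 2) / den r x).
Proof.
intros Hr; generalize (one_sub_rcos_pos r x Hr) (den_pos r x Hr); intros H1 H2.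
unfold arg1; auto_derive; [lra|].
generalize (sin2_cos2 x); unfold den, Rsqr in *; intros S.
assert (S' : sin x ^ 2 = 1 - cos x ^ 2) by (simpl; lra).
assert (Q : (1 - r * cos x) ^ 2 + r ^ 2 * sin x ^ 2 <> 0) by (rewrite S'; nra).
match goal with |- ?L = ?R => set (LL := L) end.
assert (LL = (r * cos x * (1 - r * cos x) - r ^ 2 * sin x ^ 2) /
  ((1 - r * cos x) ^ 2 + r ^ 2 * sin x ^ 2)) as ->.
{ unfold LL; field; split; [contradict Q; rewrite <- Q; ring | lra]. }
rewrite S'; f_equal; ring.
Qed.

(* [r / (1 - r)] and [r (1 + r) / (1 - r) ^ 3] are the first and third cumulants of the geometric law. *)
Lemma arg1_bounds (r x : R) : 0 <= r < 1 -> 0 <= x ->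
  - (r * (1 + r) / (1 - r) ^ 3 * x ^ 3 / 6) <= arg1 r x - r / (1 - r) * x <= 0.
Proof.
intros Hr Hx.
assert (E0 : arg1 r 0 = 0).
{ unfold arg1; rewrite sin_0, Rmult_0_r; unfold Rdiv; rewrite Rmult_0_l; apply atan_0. }
(* The derivative of [arg1] minus its value at 0 is nonpositive and at most quadratic in size;
   integrating gives both bounds. *)
assert (K : forall t, (r * cos t - r ^ 2) / den r t - r / (1 - r) =
   - (r * (1 + r) / (1 - r) * (1 - cos t) / den r t)).
{ intros t; generalize (den_pos r t Hr); unfold den; intros; field; lra. }
assert (P0 : 0 <= r * (1 + r) / (1 - r)) by (apply Rdiv_le_0_compat; nra).
split.
- set (k := r * (1 + r) / (1 - r) ^ 3).
  assert (E : arg1 r 0 - r / (1 - r) * 0 + k * 0 ^ 3 / 6 <= arg1 r x - r / (1 - r) * x + k * x ^ 3 / 6).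
  { apply (derive_nonneg_incr (fun t => arg1 r t - r / (1 - r) * t + k * t ^ 3 / 6)
      (fun t => ((r * cos t - r ^ 2) / den r t - r / (1 - r)) + k * t ^ 2 / 2)); auto.
    - intros t _.
      apply (is_derive_plus (fun t => arg1 r t - r / (1 - r) * t) (fun t => k * t ^ 3 / 6)).
      + apply (is_derive_minus (fun t => arg1 r t) (fun t => r / (1 - r) * t)).
        * now apply is_derive_arg1.
        * auto_derive; [lra | field; lra].
      + auto_derive; [easy | field].
    - intros t _; rewrite K.
      enough (r * (1 + r) / (1 - r) * (1 - cos t) / den r t <= k * t ^ 2 / 2) by lra.
      replace (k * t ^ 2 / 2) with (r * (1 + r) / (1 - r) * (t ^ 2 / 2) / (1 - r) ^ 2)
        by (unfold k; field; lra).
      generalize (cos_ge_2 t) (COS_bound t); intros.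
      apply Rmult_le_compat.
      + apply Rmult_le_pos; lra.
      + left; apply Rinv_0_lt_compat, den_pos, Hr.
      + apply Rmult_le_compat_l; lra.
      + apply Rinv_le_contravar; [apply pow_lt; lra|]; apply den_ge; lra. }
  rewrite E0 in E; unfold k in *; lra.
- assert (E : - arg1 r 0 + r / (1 - r) * 0 <= - arg1 r x + r / (1 - r) * x).
  { apply (derive_nonneg_incr (fun t => - arg1 r t + r / (1 - r) * t)
      (fun t => - ((r * cos t - r ^ 2) / den r t) + r / (1 - r))); auto.
    - intros t _.
      apply (is_derive_plus (fun t => - arg1 r t) (fun t => r / (1 - r) * t)).
      + apply (is_derive_opp (fun t => arg1 r t)).
        now apply is_derive_arg1.
      + auto_derive; [lra | field; lra].
    - intros t _; specialize (K t); generalize (COS_bound t); intros.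
      assert (0 <= r * (1 + r) / (1 - r) * (1 - cos t) / den r t); [|lra].
      apply Rdiv_le_0_compat; [nra|]; now apply den_pos. }
  rewrite E0 in E; lra.
Qed.

(** * Partition numbers as Fourier coefficients *)

(* [amp a K t * e^{i arg a K t}] is the product over [1 <= k <= K] of [1 / (1 - e^{-ak} e^{ikt})]. *)
Definition rad (a : R) (k : nat) : R := exp (- (a * INR k)).

Fixpoint amp (a : R) (K : nat) (t : R) : R :=
  match K with
  | O => 1
  | S k => amp a k t * / sqrt (den (rad a (S k)) (INR (S k) * t))
  end.

Fixpoint arg (a : R) (K : nat) (t : R) : R :=
  match K with
  | O => 0
  | S k => arg a k t + arg1 (rad a (S k)) (INR (S k) * t)
  end.

Lemma rad_bounds (a : R) (k : nat) : 0 < a -> (1 <= k)%nat -> 0 < rad a k < 1.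
Proof.
intros Ha Hk; apply exp_neg_lt_1, Rmult_lt_0_compat; [easy|]; apply lt_0_INR; lia.
Qed.

Lemma ex_derive_amp (a : R) (K : nat) (t : R) : 0 < a -> ex_derive (amp a K) t.
Proof.
intros Ha; induction K as [|K IH]; cbn [amp].
- apply ex_derive_const.
- apply (ex_derive_mult (amp a K) (fun t => / sqrt (den (rad a (S K)) (INR (S K) * t)))); [easy|].
  assert (Hr : 0 < rad a (S K) < 1) by (apply rad_bounds; [easy | lia]).
  revert Hr; generalize (rad a (S K)) (INR (S K)); intros r k Hr.
  generalize (den_pos r (k * t)); unfold den; intros Hd.
  auto_derive; split; [simpl in *; lra|]; split; [|easy].
  apply Rgt_not_eq, sqrt_lt_R0; simpl in *; lra.
Qed.

Lemma ex_derive_arg (a : R) (K : nat) (t : R) : 0 < a -> ex_derive (arg a K) t.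
Proof.
intros Ha; induction K as [|K IH]; cbn [arg].
- apply ex_derive_const.
- apply (ex_derive_plus (arg a K) (fun t => arg1 (rad a (S K)) (INR (S K) * t))); [easy|].
  assert (Hr : 0 < rad a (S K) < 1) by (apply rad_bounds; [easy | lia]).
  revert Hr; generalize (rad a (S K)) (INR (S K)); intros r k Hr.
  generalize (one_sub_rcos_pos r (k * t)); intros Hd.
  unfold arg1; auto_derive; lra.
Qed.

Lemma continuous_amp_cos (a : R) (K : nat) (y t : R) : 0 < a ->
  continuous (fun t => amp a K t * cos (arg a K t - y * t)) t.
Proof.
intros Ha; apply (ex_derive_continuous (fun t => amp a K t * cos (arg a K t - y * t))).
generalize (ex_derive_amp a K t Ha) (ex_derive_arg a K t Ha); intros.
auto_derive; easy.
Qed.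

Lemma amp_bounds (a : R) (K : nat) : 0 < a ->
  exists C, forall t, 0 < amp a K t <= C.
Proof.
intros Ha; induction K as [|K [C IH]]; cbn [amp].
- exists 1; intros; lra.
- assert (Hr : 0 < rad a (S K) < 1) by (apply rad_bounds; [easy | lia]).
  exists (C * / (1 - rad a (S K))); intros t.
  assert (H1 : 1 - rad a (S K) <= sqrt (den (rad a (S K)) (INR (S K) * t))).
  { rewrite <- (sqrt_pow2 (1 - rad a (S K))) by lra.
    apply sqrt_le_1_alt, den_ge; lra. }
  specialize (IH t); split.
  + apply Rmult_lt_0_compat; [lra|]; apply Rinv_0_lt_compat; lra.
  + apply Rmult_le_compat; try lra.
    * left; apply Rinv_0_lt_compat; lra.
    * apply Rinv_le_contravar; lra.
Qed.

(** Real part, after rotation by [e^{-iy}], of the identity [P_K = (1 - r e^{i(K+1)t}) P_{K+1}]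
    between consecutive partial products. *)
Lemma amp_cos_step (a : R) (K : nat) (t y : R) : 0 < a ->
  amp a K t * cos (arg a K t - y) =
  amp a (S K) t * cos (arg a (S K) t - y)
  - rad a (S K) * (amp a (S K) t * cos (arg a (S K) t - (y - INR (S K) * t))).
Proof.
intros Ha; cbn [amp arg].
assert (Hr : 0 < rad a (S K) < 1) by (apply rad_bounds; [easy | lia]).
set (r := rad a (S K)) in *; set (x := INR (S K) * t).
destruct (polar r x) as [Ec Es]; [lra|].
assert (Hd : 0 < sqrt (den r x)) by (apply sqrt_lt_R0, den_pos; lra).
set (g := arg a K t - y).
replace (arg a K t + arg1 r x - y) with (g + arg1 r x) by (unfold g; ring).
replace (arg a K t + arg1 r x - (y - x)) with ((g + x) + arg1 r x) by (unfold g; ring).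
rewrite !cos_plus, sin_plus.
assert (Ec' : cos (arg1 r x) = (1 - r * cos x) / sqrt (den r x)) by (rewrite <- Ec; field; lra).
assert (Es' : sin (arg1 r x) = (r * sin x) / sqrt (den r x)) by (rewrite <- Es; field; lra).
rewrite Ec', Es'.
assert (Hs : sqrt (den r x) ^ 2 = 1 - 2 * r * cos x + r ^ 2 * (cos x ^ 2 + sin x ^ 2)).
{ rewrite pow2_sqrt by (left; apply den_pos; lra); unfold den.
  generalize (sin2_cos2 x); unfold Rsqr; intros S.
  replace (cos x ^ 2 + sin x ^ 2) with 1 by (simpl; lra); ring. }
set (s := sqrt (den r x)) in *.
field_simplify_eq; [|lra].
rewrite Hs; ring.
Qed.

(** Half a period suffices because the real part is even in [t]. Integer indices are allowed because
    the recursion in [K] reaches below 0. *)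
Definition fourier (a : R) (K : nat) (z : Z) : R :=
  RInt (fun t => amp a K t * cos (arg a K t - IZR z * t)) 0 PI.

Lemma ex_RInt_amp_cos (a : R) (K : nat) (y u v : R) : 0 < a ->
  ex_RInt (fun t => amp a K t * cos (arg a K t - y * t)) u v.
Proof.
intros Ha; apply (ex_RInt_continuous (V := R_CompleteNormedModule)).
intros; now apply continuous_amp_cos.
Qed.

Lemma fourier_step (a : R) (K : nat) (z : Z) : 0 < a ->
  fourier a K z =
  fourier a (S K) z - rad a (S K) * fourier a (S K) (z - Z.of_nat (S K)).
Proof.
intros Ha; unfold fourier.
rewrite <- (RInt_scal (V := R_CompleteNormedModule)) by now apply ex_RInt_amp_cos.
rewrite <- (RInt_minus (V := R_CompleteNormedModule)).
- apply RInt_ext; intros t _; rewrite amp_cos_step by easy.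
  rewrite minus_IZR, <- INR_IZR_INZ.
  replace ((IZR z - INR (S K)) * t) with (IZR z * t - INR (S K) * t) by ring; reflexivity.
- now apply ex_RInt_amp_cos.
- apply (ex_RInt_scal (V := R_NormedModule)); now apply ex_RInt_amp_cos.
Qed.

Lemma fourier_0 (a : R) (z : Z) : fourier a 0 z = if Z.eqb z 0 then PI else 0.
Proof.
unfold fourier; simpl.
destruct (Z.eqb_spec z 0) as [-> | Hz].
- rewrite (RInt_ext _ (fun _ => 1)).
  + rewrite RInt_const; change ((PI - 0) * 1 = PI); ring.
  + intros; rewrite Rmult_0_l, Rminus_0_r, cos_0; exact (Rmult_1_l 1).
- assert (Hz' : IZR z <> 0) by now apply not_0_IZR.
  apply is_RInt_unique.
  replace 0 with (minus (sin (IZR z * PI) / IZR z) (sin (IZR z * 0) / IZR z)) at 2.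
  2:{ unfold minus, plus, opp; simpl.
      rewrite Rmult_0_r, sin_0, (sin_eq_0_1 (IZR z * PI)) by (now exists z); field; easy. }
  apply (is_RInt_derive (fun t => sin (IZR z * t) / IZR z)).
  + intros t _; auto_derive; [easy|].
    rewrite Rminus_0_l, cos_neg; field; easy.
  + intros t _.
    apply (ex_derive_continuous (fun t => 1 * cos (0 - IZR z * t))).
    auto_derive; easy.
Qed.

Lemma fourier_bound (a : R) (K : nat) : 0 < a ->
  exists C, forall z, Rabs (fourier a K z) <= C.
Proof.
intros Ha; destruct (amp_bounds a K Ha) as [C HC].
exists ((PI - 0) * C); intros z.
apply abs_RInt_le_const.
- left; apply PI_RGT_0.
- now apply ex_RInt_amp_cos.
- intros t _; specialize (HC t).
  rewrite Rabs_mult, (Rabs_pos_eq (amp a K t)) by lra.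
  generalize (COS_bound (arg a K t - IZR z * t)); intros B.
  assert (Rabs (cos (arg a K t - IZR z * t)) <= 1) by (apply Rabs_le; lra).
  generalize (Rabs_pos (cos (arg a K t - IZR z * t))); nra.
Qed.

(** Recursion for the number of partitions of [n] into parts at most [K], either without a part [K]
    or with one removed. Stated abstractly, it separates the analysis from the combinatorial
    definition. *)
Definition partition_rec (p : nat -> nat -> R) : Prop :=
  (forall n, p 0%nat n = if Nat.eqb n 0 then 1 else 0) /\
  (forall K n, p (S K) n = p K n + if Nat.leb (S K) n then p (S K) (n - S K)%nat else 0).

(** [fourier_step] is the partition recursion with weights [e^{-an}], but it determines the
    coefficients only once those of negative index are known to vanish. They do because they are
    bounded and each step downwards contributes a factor [e^{-a(K+1)}]. *)
Lemma fourier_neg_pos (a : R) (p : nat -> nat -> R) (K : nat) : 0 < a -> partition_rec p ->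
  (forall z, (z < 0)%Z -> fourier a K z = 0) /\
  (forall n, fourier a K (Z.of_nat n) = PI * (exp (- (a * INR n)) * p K n)).
Proof.
intros Ha [P0 PS]; induction K as [|K [IHn IHp]].
- split.
  + intros z Hz; rewrite fourier_0; destruct (Z.eqb_spec z 0); [lia | easy].
  + intros n; rewrite fourier_0, P0.
    destruct (Z.eqb_spec (Z.of_nat n) 0); destruct (Nat.eqb_spec n 0); try lia; try ring.
    subst n; simpl; rewrite Rmult_0_r, Ropp_0, exp_0; ring.
- assert (N : forall z, (z < 0)%Z -> fourier a (S K) z = 0).
  { intros z Hz.
    destruct (fourier_bound a (S K) Ha) as [C HC].
    assert (J : forall j, fourier a (S K) z =
      exp (- (a * INR (S K) * INR j)) * fourier a (S K) (z - Z.of_nat (j * S K))).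
    { induction j as [|j IHj].
      - rewrite Rmult_0_r, Ropp_0, exp_0, Rmult_1_l; f_equal; lia.
      - rewrite IHj, (S_INR j).
        replace (- (a * INR (S K) * (INR j + 1))) with
          (- (a * INR (S K) * INR j) + - (a * INR (S K))) by ring.
        rewrite exp_plus, (Rmult_assoc (exp _)); f_equal.
        generalize (fourier_step a K (z - Z.of_nat (j * S K)) Ha).
        rewrite IHn by lia; unfold rad; intros E.
        replace (z - Z.of_nat (S j * S K))%Z with
          (z - Z.of_nat (j * S K) - Z.of_nat (S K))%Z by lia.
        lra. }
    destruct (Req_dec (fourier a (S K) z) 0) as [|NZ]; [easy|exfalso].
    assert (HP : 0 < Rabs (fourier a (S K) z)) by now apply Rabs_pos_lt.
    assert (H1 : 0 < a * INR (S K)) by (apply Rmult_lt_0_compat; [easy|]; apply lt_0_INR; lia).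
    assert (C0 : 0 < C) by (specialize (HC z); lra).
    set (e := Rabs (fourier a (S K) z)) in *; set (b := a * INR (S K)) in *.
    (* For this [j], [C < e b j], hence [e <= e^{-bj} C < e (b j) e^{-bj} <= e], a contradiction. *)
    destruct (INR_unbounded (C / (e * b))) as [j Hj].
    specialize (J j); assert (Je : e <= exp (- (b * INR j)) * C).
    { unfold e; rewrite J, Rabs_mult, Rabs_pos_eq by (left; apply exp_pos).
      apply Rmult_le_compat_l; [left; apply exp_pos | apply HC]. }
    assert (C < e * (b * INR j)).
    { apply (Rmult_lt_compat_l (e * b)) in Hj; [|nra].
      replace (e * b * (C / (e * b))) with C in Hj by (field; lra); lra. }
    assert (E1 : exp (- (b * INR j)) * exp (b * INR j) = 1)
      by (rewrite <- exp_plus, Rplus_opp_l; apply exp_0).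
    generalize (exp_ineq1_le (b * INR j)) (exp_pos (- (b * INR j))); intros E2 E3.
    assert (exp (- (b * INR j)) * (b * INR j) <= 1) by nra.
    assert (exp (- (b * INR j)) * C < exp (- (b * INR j)) * (e * (b * INR j)))
      by (apply Rmult_lt_compat_l; lra).
    nra. }
  split; [exact N|].
  intros n; induction n as [n IH] using (well_founded_induction lt_wf).
  generalize (fourier_step a K (Z.of_nat n) Ha); rewrite IHp, PS; intros E.
  destruct (Nat.leb_spec (S K) n) as [L|L].
  + replace (Z.of_nat n - Z.of_nat (S K))%Z with (Z.of_nat (n - S K)) in E by lia.
    rewrite (IH (n - S K)%nat) in E by lia.
    assert (X : rad a (S K) * exp (- (a * INR (n - S K))) = exp (- (a * INR n))).
    { unfold rad; rewrite <- exp_plus, minus_INR by easy; f_equal; ring. }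
    rewrite <- X in *.
    set (u := p (S K) (n - S K)%nat) in *; set (ee := exp (- (a * INR (n - S K)))) in *.
    nra.
  + rewrite (N (Z.of_nat n - Z.of_nat (S K))%Z) in E by lia.
    lra.
Qed.

(** * Cumulants *)

Fixpoint bsum (f : nat -> R) (K : nat) : R :=
  match K with O => 0 | S k => bsum f k + f (S k) end.

Lemma bsum_le (f g : nat -> R) (K : nat) :
  (forall k, (1 <= k)%nat -> f k <= g k) -> bsum f K <= bsum g K.
Proof.
intros H; induction K as [|K IH]; simpl; [lra|].
specialize (H (S K)); apply Rplus_le_compat; [easy | apply H; lia].
Qed.

Lemma bsum_plus (f g : nat -> R) (K : nat) :
  bsum (fun k => f k + g k) K = bsum f K + bsum g K.
Proof. induction K as [|K IH]; simpl; [ring | rewrite IH; ring]. Qed.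

Lemma bsum_scal (c : R) (f : nat -> R) (K : nat) :
  bsum (fun k => c * f k) K = c * bsum f K.
Proof. induction K as [|K IH]; simpl; [ring | rewrite IH; ring]. Qed.

Lemma rad_eq_pow (a : R) (k : nat) : rad a k = exp (- a) ^ k.
Proof.
unfold rad; induction k as [|k IH].
- rewrite Rmult_0_r, Ropp_0, exp_0; easy.
- rewrite S_INR; simpl; rewrite <- IH, <- exp_plus; f_equal; ring.
Qed.

Lemma rad_2 (a : R) (k : nat) : rad (2 * a) k = rad a k ^ 2.
Proof. unfold rad; simpl; rewrite Rmult_1_r, <- !exp_plus; f_equal; ring. Qed.

Lemma rad_3 (a : R) (k : nat) : rad (3 * a) k = rad a k ^ 3.
Proof. unfold rad; simpl; rewrite Rmult_1_r, <- !exp_plus; f_equal; ring. Qed.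

Lemma rad_4 (a : R) (k : nat) : rad (4 * a) k = rad a k ^ 4.
Proof. unfold rad; simpl; rewrite Rmult_1_r, <- !exp_plus; f_equal; ring. Qed.

(** In this and the next three identities the right side is the full series and the term with
    [x ^ S K] is its tail beyond [K]. Dropping the tail gives upper bounds; lower bounds need it to
    be small. *)
Lemma bsum_rad_eq (y : R) (K : nat) : 0 < y -> let x := exp (- y) in
  bsum (rad y) K + x ^ S K / (1 - x) = x / (1 - x).
Proof.
intros Hy x; assert (Hx : 0 < x < 1) by now apply exp_neg_lt_1.
induction K as [|K IH]; cbn [bsum].
- simpl; field; lra.
- rewrite <- IH, rad_eq_pow; fold x; simpl; field; lra.
Qed.

Lemma bsum_id_rad_eq (y : R) (K : nat) : 0 < y -> let x := exp (- y) in
  bsum (fun k => INR k * rad y k) K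
  + x ^ S K * ((INR K + 1) / (1 - x) + x / (1 - x) ^ 2) = x / (1 - x) ^ 2.
Proof.
intros Hy x; assert (Hx : 0 < x < 1) by now apply exp_neg_lt_1.
induction K as [|K IH]; cbn [bsum].
- simpl; field; lra.
- refine (eq_trans _ IH); rewrite rad_eq_pow, S_INR; fold x; simpl; field; lra.
Qed.

Lemma bsum_sq_rad_eq (y : R) (K : nat) : 0 < y -> let x := exp (- y) in
  bsum (fun k => INR k ^ 2 * rad y k) K
  + x ^ S K * ((INR K + 1) ^ 2 / (1 - x) + 2 * (INR K + 1) * x / (1 - x) ^ 2
               + x * (1 + x) / (1 - x) ^ 3)
  = x * (1 + x) / (1 - x) ^ 3.
Proof.
intros Hy x; assert (Hx : 0 < x < 1) by now apply exp_neg_lt_1.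
induction K as [|K IH]; cbn [bsum].
- simpl; field; lra.
- refine (eq_trans _ IH); rewrite rad_eq_pow, S_INR; fold x; simpl; field; lra.
Qed.

Lemma bsum_cube_rad_eq (y : R) (K : nat) : 0 < y -> let x := exp (- y) in
  bsum (fun k => INR k ^ 3 * rad y k) K
  + x ^ S K * ((INR K + 1) ^ 3 / (1 - x) + 3 * (INR K + 1) ^ 2 * x / (1 - x) ^ 2
               + 3 * (INR K + 1) * x * (1 + x) / (1 - x) ^ 3
               + x * (1 + 4 * x + x ^ 2) / (1 - x) ^ 4)
  = x * (1 + 4 * x + x ^ 2) / (1 - x) ^ 4.
Proof.
intros Hy x; assert (Hx : 0 < x < 1) by now apply exp_neg_lt_1.
induction K as [|K IH]; cbn [bsum].
- simpl; field; lra.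
- refine (eq_trans _ IH); rewrite rad_eq_pow, S_INR; fold x; simpl; field; lra.
Qed.

Ltac pos_tac :=
  repeat first [ apply Rdiv_le_0_compat | apply Rplus_le_le_0_compat | apply Rmult_le_pos
               | apply pow_le | apply pow_lt | apply pos_INR | lra ].

(** Since [1 + x = (1 - x) + 2 x], the left side is a product of the two geometric expressions
    already bounded. *)
Lemma geo3_le (y : R) : 0 < y -> let x := exp (- y) in
  x * (1 + x) / (1 - x) ^ 3 <= 2 / y ^ 3 + / y ^ 2.
Proof.
intros Hy x; assert (Hx : 0 < x < 1) by now apply exp_neg_lt_1.
generalize (geo_le_inv y Hy) (geo_sq_le_inv y Hy); fold x; intros H1 H2.
replace (x * (1 + x) / (1 - x) ^ 3) with (x / (1 - x) ^ 2 * (1 + 2 * (x / (1 - x)))) by (field; lra).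
replace (2 / y ^ 3 + / y ^ 2) with (/ y ^ 2 * (1 + 2 * / y)) by (field; lra).
apply Rmult_le_compat; [pos_tac | | easy | lra].
assert (0 <= x / (1 - x)) by pos_tac; lra.
Qed.

Lemma bsum_rad_le (y : R) (K : nat) : 0 < y -> bsum (rad y) K <= / y.
Proof.
intros Hy; assert (Hx : 0 < exp (- y) < 1) by now apply exp_neg_lt_1.
generalize (bsum_rad_eq y K Hy) (geo_le_inv y Hy); simpl; intros E H.
assert (0 <= exp (- y) * exp (- y) ^ K / (1 - exp (- y))) by pos_tac; lra.
Qed.

Lemma bsum_id_rad_le (y : R) (K : nat) : 0 < y -> bsum (fun k => INR k * rad y k) K <= / y ^ 2.
Proof.
intros Hy; assert (Hx : 0 < exp (- y) < 1) by now apply exp_neg_lt_1.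
generalize (bsum_id_rad_eq y K Hy) (geo_sq_le_inv y Hy); set (x := exp (- y)) in *; cbn zeta; intros E H.
assert (0 <= x ^ S K * ((INR K + 1) / (1 - x) + x / (1 - x) ^ 2)) by pos_tac; lra.
Qed.

Lemma bsum_sq_rad_le (y : R) (K : nat) : 0 < y ->
  bsum (fun k => INR k ^ 2 * rad y k) K <= 2 / y ^ 3 + / y ^ 2.
Proof.
intros Hy; assert (Hx : 0 < exp (- y) < 1) by now apply exp_neg_lt_1.
generalize (bsum_sq_rad_eq y K Hy) (geo3_le y Hy); set (x := exp (- y)) in *; cbn zeta; intros E H.
assert (0 <= x ^ S K * ((INR K + 1) ^ 2 / (1 - x) + 2 * (INR K + 1) * x / (1 - x) ^ 2
               + x * (1 + x) / (1 - x) ^ 3)) by pos_tac; lra.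
Qed.

Lemma bsum_cube_rad_le (y : R) (K : nat) : 0 < y ->
  bsum (fun k => INR k ^ 3 * rad y k) K <= 6 / y ^ 4 + / y ^ 2.
Proof.
intros Hy; assert (Hx : 0 < exp (- y) < 1) by now apply exp_neg_lt_1.
generalize (bsum_cube_rad_eq y K Hy) (geo_sq_le_inv y Hy); set (x := exp (- y)) in *; cbn zeta; intros E H.
assert (0 <= x ^ S K * ((INR K + 1) ^ 3 / (1 - x) + 3 * (INR K + 1) ^ 2 * x / (1 - x) ^ 2
               + 3 * (INR K + 1) * x * (1 + x) / (1 - x) ^ 3
               + x * (1 + 4 * x + x ^ 2) / (1 - x) ^ 4)) by pos_tac.
assert (H2 : (x / (1 - x) ^ 2) ^ 2 <= (/ y ^ 2) ^ 2) by (apply pow_incr; split; [pos_tac | easy]).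
assert (E2 : x * (1 + 4 * x + x ^ 2) / (1 - x) ^ 4 = 6 * (x / (1 - x) ^ 2) ^ 2 + x / (1 - x) ^ 2)
  by (field; lra).
assert (E3 : 6 / y ^ 4 = 6 * (/ y ^ 2) ^ 2) by (field; lra).
lra.
Qed.

(** These are the first three cumulants of the size of a random partition with parts at most [K],
    weighted by [e^{-a size}]: the multiplicities are independent geometric variables, and part [k]
    contributes [k^j] times the [j]-th geometric cumulant. *)
Definition mean_size (a : R) (K : nat) : R :=
  bsum (fun k => INR k * (rad a k / (1 - rad a k))) K.
Definition cumulant2 (a : R) (K : nat) : R :=
  bsum (fun k => INR k ^ 2 * (rad a k / (1 - rad a k) ^ 2)) K.
Definition cumulant3 (a : R) (K : nat) : R :=
  bsum (fun k => INR k ^ 3 * (rad a k * (1 + rad a k) / (1 - rad a k) ^ 3)) K.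

(* Each cumulant is a double sum over [k] and over powers [r^m]; the terms [m <= 4] are summed exactly over [k]
   and the remaining ones are bounded by their value for small [ak]. *)
Lemma mean_size_le (a : R) (K : nat) : 0 < a -> mean_size a K <= 1.68 / a ^ 2.
Proof.
intros Ha; unfold mean_size.
apply Rle_trans with (bsum (fun k => (INR k * rad a k + INR k * rad (2 * a) k)
  + (INR k * rad (3 * a) k + INR k * rad (4 * a) k) + / a * rad (4 * a) k) K).
- apply bsum_le; intros k Hk.
  generalize (rad_bounds a k Ha Hk); intros Hr.
  assert (HK : 0 < INR k) by (apply lt_0_INR; lia).
  generalize (geo_le_inv (a * INR k)); fold (rad a k); intros G.
  rewrite rad_2, rad_3, rad_4; set (r := rad a k) in *.
  assert (G' : r / (1 - r) <= / (a * INR k)) by (apply G, Rmult_lt_0_compat; lra).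
  replace (r / (1 - r)) with (r + r ^ 2 + r ^ 3 + r ^ 4 + r ^ 4 * (r / (1 - r))) by (field; lra).
  replace (/ a * r ^ 4) with (INR k * (r ^ 4 * / (a * INR k))) by (field; lra).
  assert (r ^ 4 * (r / (1 - r)) <= r ^ 4 * / (a * INR k)) by (apply Rmult_le_compat_l; [pos_tac | easy]).
  nra.
- rewrite !bsum_plus, bsum_scal.
  generalize (bsum_id_rad_le a K Ha) (bsum_id_rad_le (2 * a) K) (bsum_id_rad_le (3 * a) K)
    (bsum_id_rad_le (4 * a) K) (bsum_rad_le (4 * a) K); intros H1 H2 H3 H4 H5.
  assert (Hb : 0 < / a) by now apply Rinv_0_lt_compat.
  apply Rle_trans with ((/ a ^ 2 + / (2 * a) ^ 2) + (/ (3 * a) ^ 2 + / (4 * a) ^ 2) + / a * / (4 * a)).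
  + repeat apply Rplus_le_compat; try (first [apply H1 | apply H2 | apply H3 | apply H4]; lra).
    apply Rmult_le_compat_l; [lra | apply H5; lra].
  + replace (_ + _) with ((1 + / 4 + / 9 + / 16 + / 4) * / a ^ 2) by (field; lra).
    unfold Rdiv; apply Rmult_le_compat_r; [|lra].
    left; apply Rinv_0_lt_compat, pow_lt, Ha.
Qed.

(** For [K] infinite and [a] tending to 0 the leading constants of the three cumulants are [pi^2/6],
    [pi^2/3] and [pi^2]; the values 1.68, 3.5 and 10.56 also absorb lower-order terms. Later they
    appear as [3.5/2 = 1.75] in the Gaussian and [10.56/6 = 1.76] in the phase. *)
Lemma cumulant2_le (a : R) (K : nat) : 0 < a <= 0.029 -> cumulant2 a K <= 3.5 / a ^ 3.
Proof.
intros [Ha Ha']; unfold cumulant2.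
apply Rle_trans with (bsum (fun k => (INR k ^ 2 * rad a k + 2 * (INR k ^ 2 * rad (2 * a) k))
  + (3 * (INR k ^ 2 * rad (3 * a) k) + 4 * (INR k ^ 2 * rad (4 * a) k))
  + (4 * / a * (INR k * rad (4 * a) k) + / a ^ 2 * rad (4 * a) k)) K).
- apply bsum_le; intros k Hk.
  generalize (rad_bounds a k Ha Hk); intros Hr.
  assert (HK : 0 < INR k) by (apply lt_0_INR; lia).
  generalize (geo_le_inv (a * INR k)) (geo_sq_le_inv (a * INR k)); fold (rad a k); intros G G2.
  rewrite rad_2, rad_3, rad_4; set (r := rad a k) in *.
  assert (G' : r / (1 - r) <= / (a * INR k)) by (apply G, Rmult_lt_0_compat; lra).
  assert (G2' : r / (1 - r) ^ 2 <= / (a * INR k) ^ 2) by (apply G2, Rmult_lt_0_compat; lra).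
  replace (r / (1 - r) ^ 2) with (r + 2 * r ^ 2 + 3 * r ^ 3 + 4 * r ^ 4
    + r ^ 4 * (4 * (r / (1 - r)) + r / (1 - r) ^ 2)) by (field; lra).
  replace (4 * / a * (INR k * r ^ 4) + / a ^ 2 * r ^ 4) with
    (INR k ^ 2 * (r ^ 4 * (4 * / (a * INR k) + / (a * INR k) ^ 2))) by (field; lra).
  assert (r ^ 4 * (4 * (r / (1 - r)) + r / (1 - r) ^ 2) <= r ^ 4 * (4 * / (a * INR k) + / (a * INR k) ^ 2))
    by (apply Rmult_le_compat_l; [pos_tac | lra]).
  assert (0 < INR k ^ 2) by now apply pow_lt.
  nra.
- rewrite !bsum_plus, !bsum_scal.
  generalize (bsum_sq_rad_le a K Ha) (bsum_sq_rad_le (2 * a) K) (bsum_sq_rad_le (3 * a) K)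
    (bsum_sq_rad_le (4 * a) K) (bsum_id_rad_le (4 * a) K) (bsum_rad_le (4 * a) K); intros H1 H2 H3 H4 H5 H6.
  assert (Hb : 0 < / a) by now apply Rinv_0_lt_compat.
  assert (Hb2 : 0 < / a ^ 2) by now apply Rinv_0_lt_compat, pow_lt.
  apply Rle_trans with (((2 / a ^ 3 + / a ^ 2) + 2 * (2 / (2 * a) ^ 3 + / (2 * a) ^ 2))
    + (3 * (2 / (3 * a) ^ 3 + / (3 * a) ^ 2) + 4 * (2 / (4 * a) ^ 3 + / (4 * a) ^ 2))
    + (4 * / a * / (4 * a) ^ 2 + / a ^ 2 * / (4 * a))).
  + repeat apply Rplus_le_compat; try apply Rmult_le_compat_l; try lra;
      first [apply H2 | apply H3 | apply H4 | apply H5 | apply H6]; lra.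
  + replace (_ + _) with ((2 * (1 + / 4 + / 9 + / 16) + 1 / 2 + (1 + / 2 + / 3 + / 4) * a) * / a ^ 3)
      by (field; lra).
    unfold Rdiv; apply Rmult_le_compat_r; [|lra].
    left; apply Rinv_0_lt_compat, pow_lt, Ha.
Qed.

Lemma cumulant3_le (a : R) (K : nat) : 0 < a <= 0.029 -> cumulant3 a K <= 10.56 / a ^ 4.
Proof.
intros [Ha Ha']; unfold cumulant3.
apply Rle_trans with (bsum (fun k => (INR k ^ 3 * rad a k + 4 * (INR k ^ 3 * rad (2 * a) k))
  + (9 * (INR k ^ 3 * rad (3 * a) k) + 16 * (INR k ^ 3 * rad (4 * a) k))
  + ((16 * / a * (INR k ^ 2 * rad (4 * a) k) + 9 * / a ^ 2 * (INR k * rad (4 * a) k))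
     + 2 * / a ^ 3 * rad (4 * a) k)) K).
- apply bsum_le; intros k Hk.
  generalize (rad_bounds a k Ha Hk); intros Hr.
  assert (HK : 0 < INR k) by (apply lt_0_INR; lia).
  generalize (geo_le_inv (a * INR k)) (geo_sq_le_inv (a * INR k)) (geo3_le (a * INR k));
    fold (rad a k); cbn zeta; intros G G2 G3.
  rewrite rad_2, rad_3, rad_4; set (r := rad a k) in *.
  assert (G' : r / (1 - r) <= / (a * INR k)) by (apply G, Rmult_lt_0_compat; lra).
  assert (G2' : r / (1 - r) ^ 2 <= / (a * INR k) ^ 2) by (apply G2, Rmult_lt_0_compat; lra).
  assert (G3' : r * (1 + r) / (1 - r) ^ 3 <= 2 / (a * INR k) ^ 3 + / (a * INR k) ^ 2)
    by (apply G3, Rmult_lt_0_compat; lra).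
  replace (r * (1 + r) / (1 - r) ^ 3) with (r + 4 * r ^ 2 + 9 * r ^ 3 + 16 * r ^ 4
    + r ^ 4 * (16 * (r / (1 - r)) + 8 * (r / (1 - r) ^ 2) + r * (1 + r) / (1 - r) ^ 3)) by (field; lra).
  replace (16 * / a * (INR k ^ 2 * r ^ 4) + 9 * / a ^ 2 * (INR k * r ^ 4) + 2 * / a ^ 3 * r ^ 4) with
    (INR k ^ 3 * (r ^ 4 * (16 * / (a * INR k) + 8 * / (a * INR k) ^ 2
       + (2 / (a * INR k) ^ 3 + / (a * INR k) ^ 2)))) by (field; lra).
  assert (r ^ 4 * (16 * (r / (1 - r)) + 8 * (r / (1 - r) ^ 2) + r * (1 + r) / (1 - r) ^ 3) <=
    r ^ 4 * (16 * / (a * INR k) + 8 * / (a * INR k) ^ 2 + (2 / (a * INR k) ^ 3 + / (a * INR k) ^ 2)))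
    by (apply Rmult_le_compat_l; [pos_tac | lra]).
  assert (0 < INR k ^ 3) by now apply pow_lt.
  nra.
- rewrite !bsum_plus, !bsum_scal.
  generalize (bsum_cube_rad_le a K Ha) (bsum_cube_rad_le (2 * a) K) (bsum_cube_rad_le (3 * a) K)
    (bsum_cube_rad_le (4 * a) K) (bsum_sq_rad_le (4 * a) K) (bsum_id_rad_le (4 * a) K)
    (bsum_rad_le (4 * a) K); intros H1 H2 H3 H4 H5 H6 H7.
  assert (Hb : 0 < / a) by now apply Rinv_0_lt_compat.
  assert (Hb2 : 0 < / a ^ 2) by now apply Rinv_0_lt_compat, pow_lt.
  assert (Hb3 : 0 < / a ^ 3) by now apply Rinv_0_lt_compat, pow_lt.
  apply Rle_trans with (((6 / a ^ 4 + / a ^ 2) + 4 * (6 / (2 * a) ^ 4 + / (2 * a) ^ 2))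
    + (9 * (6 / (3 * a) ^ 4 + / (3 * a) ^ 2) + 16 * (6 / (4 * a) ^ 4 + / (4 * a) ^ 2))
    + ((16 * / a * (2 / (4 * a) ^ 3 + / (4 * a) ^ 2) + 9 * / a ^ 2 * / (4 * a) ^ 2)
       + 2 * / a ^ 3 * / (4 * a))).
  + repeat apply Rplus_le_compat; try apply Rmult_le_compat_l; try lra;
      first [apply H2 | apply H3 | apply H4 | apply H5 | apply H6 | apply H7]; lra.
  + replace (_ + _) with ((6 * (1 + / 4 + / 9 + / 16) + 1 / 2 + 9 / 16 + 1 / 2 + a + 4 * a ^ 2) * / a ^ 4)
      by (field; lra).
    unfold Rdiv; apply Rmult_le_compat_r; [|nra].
    left; apply Rinv_0_lt_compat, pow_lt, Ha.
Qed.

(** * Modulus and phase of the product *)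

Lemma sqrt_den_0 (r : R) : 0 <= r < 1 -> sqrt (den r 0) = 1 - r.
Proof.
intros Hr; rewrite den_eq, cos_0, Rminus_diag, Rmult_0_r, Rplus_0_r.
apply sqrt_pow2; lra.
Qed.

Lemma exp_sq (x : R) : exp x ^ 2 = exp (2 * x).
Proof. simpl; rewrite Rmult_1_r, <- exp_plus; f_equal; ring. Qed.

Lemma exp_le (x y : R) : x <= y -> exp x <= exp y.
Proof. intros [H | ->]; [left; now apply exp_increasing | right; easy]. Qed.

Lemma inv_sqrt_den_le (r x X : R) : 0 <= r < 1 ->
  (1 - r) ^ 2 * exp (2 * X) <= den r x -> / sqrt (den r x) <= / (1 - r) * exp (- X).
Proof.
intros Hr H; rewrite exp_Ropp, <- Rinv_mult.
generalize (exp_pos X); intros HX.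
apply Rinv_le_contravar; [apply Rmult_lt_0_compat; lra|].
rewrite <- (sqrt_pow2 ((1 - r) * exp X)) by (apply Rmult_le_pos; lra).
apply sqrt_le_1_alt; rewrite Rpow_mult_distr, exp_sq; easy.
Qed.

Lemma inv_sqrt_den_ge (r x X : R) : 0 <= r < 1 ->
  den r x <= (1 - r) ^ 2 * exp (2 * X) -> / (1 - r) * exp (- X) <= / sqrt (den r x).
Proof.
intros Hr H; rewrite exp_Ropp, <- Rinv_mult.
generalize (exp_pos X); intros HX.
apply Rinv_le_contravar; [apply sqrt_lt_R0, den_pos, Hr|].
rewrite <- (sqrt_pow2 ((1 - r) * exp X)) by (apply Rmult_le_pos; lra).
apply sqrt_le_1_alt; rewrite Rpow_mult_distr, exp_sq; easy.
Qed.

Lemma amp_0 (a : R) (K : nat) : 0 < a ->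
  amp a (S K) 0 = amp a K 0 * / (1 - rad a (S K)).
Proof.
intros Ha; cbn [amp]; rewrite Rmult_0_r, sqrt_den_0; [easy|].
generalize (rad_bounds a (S K) Ha); intros; assert (1 <= S K)%nat by lia; intuition lra.
Qed.

Lemma amp_pos (a : R) (K : nat) (t : R) : 0 < a -> 0 < amp a K t.
Proof. intros Ha; destruct (amp_bounds a K Ha) as [C HC]; apply HC. Qed.

(** [den_le_exp] applied to each factor; the geometric variances, scaled by [k^2], add up to
    [cumulant2]. *)
Lemma amp_ge (a : R) (K : nat) (t : R) : 0 < a ->
  amp a K 0 * exp (- (cumulant2 a K * t ^ 2 / 2)) <= amp a K t.
Proof.
intros Ha; unfold cumulant2; induction K as [|K IH].
- simpl; rewrite Rmult_0_l; unfold Rdiv; rewrite Rmult_0_l, Ropp_0, exp_0; lra.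
- rewrite amp_0 by easy; cbn [amp bsum].
  assert (Hr : 0 < rad a (S K) < 1) by (apply rad_bounds; [easy | lia]).
  set (r := rad a (S K)) in *; set (s := bsum _ K) in *; set (k := INR (S K)).
  replace (- ((s + k ^ 2 * (r / (1 - r) ^ 2)) * t ^ 2 / 2)) with
    (- (s * t ^ 2 / 2) + - (r / (1 - r) ^ 2 * (k * t) ^ 2 / 2)) by (field; lra).
  rewrite exp_plus.
  replace (_ * _) with ((amp a K 0 * exp (- (s * t ^ 2 / 2))) *
    (/ (1 - r) * exp (- (r / (1 - r) ^ 2 * (k * t) ^ 2 / 2)))) by ring.
  apply Rmult_le_compat; [| |easy|].
  + apply Rmult_le_pos; left; [now apply amp_pos | apply exp_pos].
  + apply Rmult_le_pos; left; [apply Rinv_0_lt_compat; lra | apply exp_pos].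
  + apply inv_sqrt_den_ge; [lra|].
    replace (2 * (r / (1 - r) ^ 2 * (k * t) ^ 2 / 2)) with (r / (1 - r) ^ 2 * (k * t) ^ 2) by (field; lra).
    apply den_le_exp; lra.
Qed.

(** The terms [m = 1, 2] of [log (amp a K 0 / amp a K t)]. The second is written as the first at
    [(2a, 2t)], so that one estimate serves both. *)
Definition decay (a : R) (K : nat) (t : R) : R :=
  bsum (fun k => rad a k * (1 - cos (INR k * t))) K
  + bsum (fun k => rad (2 * a) k * (1 - cos (INR k * (2 * t)))) K / 2.

Lemma bsum_rad_cos_nonneg (y t : R) (K : nat) :
  0 <= bsum (fun k => rad y k * (1 - cos (INR k * t))) K.
Proof.
induction K as [|K IH]; cbn [bsum]; [lra|].
apply Rplus_le_le_0_compat; [easy|].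
apply Rmult_le_pos; [left; apply exp_pos|].
generalize (COS_bound (INR (S K) * t)); lra.
Qed.

Lemma decay_nonneg (a : R) (K : nat) (t : R) : 0 <= decay a K t.
Proof.
unfold decay; generalize (bsum_rad_cos_nonneg a t K) (bsum_rad_cos_nonneg (2 * a) (2 * t) K); lra.
Qed.

Lemma amp_le (a : R) (K : nat) (t : R) : 0 < a ->
  amp a K t <= amp a K 0 * exp (- decay a K t).
Proof.
intros Ha; unfold decay; induction K as [|K IH].
- simpl; unfold Rdiv; rewrite Rmult_0_l, Rplus_0_l, Ropp_0, exp_0; lra.
- rewrite amp_0 by easy; cbn [amp bsum].
  assert (Hr : 0 < rad a (S K) < 1) by (apply rad_bounds; [easy | lia]).
  rewrite rad_2.
  set (r := rad a (S K)) in *; set (k := INR (S K)).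
  revert IH; generalize (bsum (fun k => rad a k * (1 - cos (INR k * t))) K)
    (bsum (fun k => rad (2 * a) k * (1 - cos (INR k * (2 * t)))) K); intros s s' IH.
  match goal with |- context [exp (- ?X)] => replace (- X) with
    (- (s + s' / 2) + - (r * (1 - cos (k * t)) + r ^ 2 * (1 - cos (k * (2 * t))) / 2)) by field end.
  rewrite exp_plus.
  replace (amp a K 0 * / (1 - r) * _) with ((amp a K 0 * exp (- (s + s' / 2))) *
    (/ (1 - r) * exp (- (r * (1 - cos (k * t)) + r ^ 2 * (1 - cos (k * (2 * t))) / 2)))) by ring.
  apply Rmult_le_compat; [| |easy|].
  + left; now apply amp_pos.
  + left; apply Rinv_0_lt_compat, sqrt_lt_R0, den_pos; lra.
  + apply inv_sqrt_den_le; [lra|].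
    replace (k * (2 * t)) with (2 * (k * t)) by ring.
    apply den_ge_exp; lra.
Qed.

(** Sum of [arg1_bounds] over the factors. The linear coefficient is [mean_size], so solving
    [mean_size a K = n] removes the linear term of the phase. *)
Lemma arg_bounds (a : R) (K : nat) (t : R) : 0 < a -> 0 <= t ->
  - (cumulant3 a K * t ^ 3 / 6) <= arg a K t - mean_size a K * t <= 0.
Proof.
intros Ha Ht; unfold cumulant3, mean_size; induction K as [|K IH]; cbn [arg bsum]; [lra|].
assert (Hr : 0 < rad a (S K) < 1) by (apply rad_bounds; [easy | lia]).
assert (Hk : 0 <= INR (S K)) by apply pos_INR.
generalize (arg1_bounds (rad a (S K)) (INR (S K) * t)).
set (r := rad a (S K)) in *; set (k := INR (S K)) in *; intros B.
destruct B as [B1 B2]; [lra | now apply Rmult_le_pos |].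
rewrite Rpow_mult_distr in B1.
split; nra.
Qed.

(** * Lower bounds for the decay of the modulus *)

Lemma bsum_rad_cos_eq (y t : R) (K : nat) : let x := exp (- y) in
  bsum (fun k => rad y k * cos (INR k * t)) K * den x t =
  x * cos t - x ^ 2 - x ^ S K * cos ((INR K + 1) * t) + x ^ S (S K) * cos (INR K * t).
Proof.
intros x; induction K as [|K IH].
- simpl; rewrite Rplus_0_l, Rmult_1_l, !Rmult_0_l, cos_0; ring.
- cbn [bsum]; rewrite Rmult_plus_distr_r, IH, rad_eq_pow, S_INR; fold x.
  unfold den.
  replace ((INR K + 1 + 1) * t) with ((INR K + 1) * t + t) by ring.
  replace (INR K * t) with ((INR K + 1) * t - t) by ring.
  rewrite cos_plus, cos_minus; simpl; ring.
Qed.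

(** The infinite sum equals [(1 + x) / (2 (1 - x))] times the displayed ratio, and [coth_half_ge]
    bounds that prefactor below by [1/y]. Cutting at [K] costs at most three times
    [x^K / (1 - x)^2]: one for the plain geometric tail, two for the cosine sum. *)
Lemma bsum_rad_cos_ge (y t : R) (K : nat) : 0 < y ->
  / y * (2 * exp (- y) * (1 - cos t) / den (exp (- y)) t)
    - 3 * rad y K / (1 - exp (- y)) ^ 2
  <= bsum (fun k => rad y k * (1 - cos (INR k * t))) K.
Proof.
intros Hy; generalize (bsum_rad_cos_eq y t K) (bsum_rad_eq y K Hy) (coth_half_ge y Hy); cbn zeta.
assert (Hx : 0 < exp (- y) < 1) by now apply exp_neg_lt_1.
rewrite rad_eq_pow; set (x := exp (- y)) in *; intros E1 E2 H3.
assert (E3 : bsum (fun k => rad y k * (1 - cos (INR k * t))) K =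
  bsum (rad y) K - bsum (fun k => rad y k * cos (INR k * t)) K).
{ clear; induction K as [|K IH]; cbn [bsum]; [ring | rewrite IH; ring]. }
rewrite E3.
assert (Hd : 0 < den x t) by (apply den_pos; lra).
assert (Hd2 : (1 - x) ^ 2 <= den x t) by (apply den_ge; lra).
assert (Hq : 0 < (1 - x) ^ 2) by (apply pow_lt; lra).
set (T := bsum (fun k => rad y k * cos (INR k * t)) K) in *.
set (U := bsum (rad y) K) in *.
assert (ET : T = (x * cos t - x ^ 2 - x ^ S K * cos ((INR K + 1) * t) + x ^ S (S K) * cos (INR K * t)) / den x t)
  by (rewrite <- E1; field; lra).
assert (EU : U = x / (1 - x) - x ^ S K / (1 - x)) by lra.
rewrite ET, EU.
replace (x / (1 - x) - x ^ S K / (1 - x) - _) with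
  (/ 2 * ((1 + x) / (1 - x)) * (2 * x * (1 - cos t) / den x t)
   - (x ^ K * x) / (1 - x) + x ^ K * (x * cos ((INR K + 1) * t) - x ^ 2 * cos (INR K * t)) / den x t)
  by (unfold den in *; simpl pow; field; lra).
assert (P1 : 0 <= 2 * x * (1 - cos t) / den x t).
{ generalize (COS_bound t); intros; apply Rdiv_le_0_compat; [nra|easy]. }
assert (HxK : 0 <= x ^ K) by (apply pow_le; lra).
assert (P2 : x ^ K * x / (1 - x) <= x ^ K / (1 - x) ^ 2).
{ replace (x ^ K * x / (1 - x)) with (x ^ K * (x * (1 - x)) / (1 - x) ^ 2) by (field; lra).
  apply Rmult_le_compat_r; [left; now apply Rinv_0_lt_compat|]; nra. }
assert (P3 : - (2 * (x ^ K / (1 - x) ^ 2)) <=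
  x ^ K * (x * cos ((INR K + 1) * t) - x ^ 2 * cos (INR K * t)) / den x t).
{ generalize (COS_bound ((INR K + 1) * t)) (COS_bound (INR K * t)); intros C1 C2.
  assert (-2 <= x * cos ((INR K + 1) * t) - x ^ 2 * cos (INR K * t)) by nra.
  apply Rle_trans with (- (2 * (x ^ K / den x t))).
  - apply Ropp_le_contravar, Rmult_le_compat_l; [lra|].
    apply Rmult_le_compat_l; [easy|]; now apply Rinv_le_contravar.
  - replace (- (2 * (x ^ K / den x t))) with (x ^ K * (-2) / den x t) by (field; lra).
    apply Rmult_le_compat_r; [left; now apply Rinv_0_lt_compat|].
    apply Rmult_le_compat_l; easy. }
assert (P4 : / y * (2 * x * (1 - cos t) / den x t) <=
   / 2 * ((1 + x) / (1 - x)) * (2 * x * (1 - cos t) / den x t)).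
{ apply Rmult_le_compat_r; [easy|]. unfold Rdiv in *; lra. }
replace (3 * x ^ K / (1 - x) ^ 2) with (3 * (x ^ K / (1 - x) ^ 2)) by (field; lra).
lra.
Qed.

(** By [den_eq] the right side is [Q / (e + Q)] with [e = (1 - exp (- y))^2 <= y^2]; such a quotient
    increases in [Q] and decreases in [e]. *)
Lemma ratio_ge (y q s : R) : 0 < y <= 1 -> 0 <= q <= 2 * exp (- y) * (1 - cos s) ->
  q / (y ^ 2 + q) <= 2 * exp (- y) * (1 - cos s) / den (exp (- y)) s.
Proof.
intros Hy Hq; rewrite den_eq; set (Q := 2 * exp (- y) * (1 - cos s)) in *.
generalize (one_sub_exp_bounds y) (exp_neg_lt_1 y); intros H H'.
assert (0 < 1 - exp (- y) <= y) by lra.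
assert (H1 : 0 < (1 - exp (- y)) ^ 2) by (apply pow_lt; lra).
assert (H2 : (1 - exp (- y)) ^ 2 <= y ^ 2) by (apply pow_incr; lra).
set (e := (1 - exp (- y)) ^ 2) in *.
assert (H3 : q * e <= Q * y ^ 2) by (apply Rmult_le_compat; lra).
apply Rmult_le_reg_r with ((y ^ 2 + q) * (e + Q)); [apply Rmult_lt_0_compat; lra|].
replace (q / (y ^ 2 + q) * ((y ^ 2 + q) * (e + Q))) with (q * (e + Q)) by (field; lra).
replace (Q / (e + Q) * ((y ^ 2 + q) * (e + Q))) with (Q * (y ^ 2 + q)) by (field; lra).
lra.
Qed.

Lemma ratio_ge_small (y s : R) : 0 < y <= 1 -> 0 <= s <= 1 ->
  (1 - y) * (1 - s ^ 2 / 12) * (s ^ 2 / (y ^ 2 + s ^ 2))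
  <= 2 * exp (- y) * (1 - cos s) / den (exp (- y)) s.
Proof.
intros Hy Hs; set (m := (1 - y) * (1 - s ^ 2 / 12)).
assert (Hm : 0 <= m <= 1).
{ assert (0 <= 1 - s ^ 2 / 12 <= 1) by nra; unfold m; nra. }
assert (H1 : m * s ^ 2 <= 2 * exp (- y) * (1 - cos s)).
{ generalize (cos_le_4 s) (exp_ineq1_le (- y)); intros H1 H2.
  replace (m * s ^ 2) with ((1 - y) * (s ^ 2 - s ^ 4 / 12)) by (unfold m; field).
  replace (2 * exp (- y) * (1 - cos s)) with (exp (- y) * (2 * (1 - cos s))) by ring.
  apply Rmult_le_compat; [lra | | lra | lra].
  replace (s ^ 2 - s ^ 4 / 12) with (s ^ 2 * (1 - s ^ 2 / 12)) by field.
  apply Rmult_le_pos; nra. }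
apply Rle_trans with (m * s ^ 2 / (y ^ 2 + m * s ^ 2)).
- unfold Rdiv; rewrite <- Rmult_assoc.
  apply Rmult_le_compat_l; [nra|]; apply Rinv_le_contravar; nra.
- apply ratio_ge; [easy|]; split; [nra | easy].
Qed.

(** The scale [a^2] offsets the factor [1 / (1 - e^{-a})^2] carried by the truncation errors. *)
Definition negligible_tail (a : R) (K : nat) : Prop := (INR K + 1) * rad a K <= a ^ 2 / 1000.

Lemma tail_terms (a : R) (K : nat) : 0 < a <= 0.029 -> (1 <= K)%nat -> negligible_tail a K ->
  3 * rad a K / (1 - exp (- a)) ^ 2 <= 0.0017 /\
  3 * rad (2 * a) K / (1 - exp (- (2 * a))) ^ 2 <= 0.0006.
Proof.
unfold negligible_tail; intros Ha HK HT.
generalize (one_sub_exp_bounds a) (one_sub_exp_bounds (2 * a)); intros B1 B2.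
assert (H1 : 0.985 * a <= 1 - exp (- a)) by nra.
assert (H2 : 1.94 * a <= 1 - exp (- (2 * a))) by nra.
assert (HK' : 1 <= INR K) by (apply (le_INR 1); easy).
assert (Hr := rad_bounds a K (proj1 Ha) HK).
assert (Hr1 : rad a K <= a ^ 2 / 2000) by nra.
assert (Hr2 : rad (2 * a) K <= a ^ 2 / 2000) by (rewrite rad_2; nra).
assert (Hr3 : 0 <= rad (2 * a) K) by (left; apply exp_pos).
split.
- apply Rle_trans with (3 * (a ^ 2 / 2000) / (0.985 * a) ^ 2).
  + apply Rmult_le_compat; [lra | | lra |].
    * left; apply Rinv_0_lt_compat, pow_lt; lra.
    * apply Rinv_le_contravar; [apply pow_lt; lra | apply pow_incr; lra].
  + replace (3 * (a ^ 2 / 2000) / (0.985 * a) ^ 2) with (3 / 2000 / 0.985 ^ 2) by (field; lra); lra.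
- apply Rle_trans with (3 * (a ^ 2 / 2000) / (1.94 * a) ^ 2).
  + apply Rmult_le_compat; [lra | | lra |].
    * left; apply Rinv_0_lt_compat, pow_lt; lra.
    * apply Rinv_le_contravar; [apply pow_lt; lra | apply pow_incr; lra].
  + replace (3 * (a ^ 2 / 2000) / (1.94 * a) ^ 2) with (3 / 2000 / 1.94 ^ 2) by (field; lra); lra.
Qed.

Lemma decay_ge_near (a : R) (K : nat) (t : R) : 0 < a <= 0.029 -> (1 <= K)%nat -> negligible_tail a K ->
  0 <= t <= 2 * a -> 1.2 / a * (t ^ 2 / (a ^ 2 + t ^ 2)) - 0.002 <= decay a K t.
Proof.
intros Ha HK HT Ht; destruct (tail_terms a K Ha HK HT) as [T1 T2].
generalize (bsum_rad_cos_ge a t K) (bsum_rad_cos_ge (2 * a) (2 * t) K)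
  (ratio_ge_small a t) (ratio_ge_small (2 * a) (2 * t)); intros B1 B2 R1 R2.
replace ((2 * t) ^ 2 / ((2 * a) ^ 2 + (2 * t) ^ 2)) with (t ^ 2 / (a ^ 2 + t ^ 2)) in R2 by (field; nra).
unfold decay.
assert (Hv : 0 <= t ^ 2 / (a ^ 2 + t ^ 2)) by (apply Rdiv_le_0_compat; nra).
set (v := t ^ 2 / (a ^ 2 + t ^ 2)) in *.
assert (Hi : 0 < / a) by (apply Rinv_0_lt_compat; lra).
(* The ratio [v] is the same at [(a, t)] and [(2a, 2t)]. The two terms enter with weights [1/a] and
   [1/(4a)], and [0.97 + 0.94/4 >= 1.2]; the truncation loss is [0.0017 + 0.0006/2 = 0.002]. *)
assert (M1 : 0.97 * v <= 2 * exp (- a) * (1 - cos t) / den (exp (- a)) t).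
{ eapply Rle_trans; [|apply R1; lra]. apply Rmult_le_compat_r; [easy|]; nra. }
assert (M2 : 0.94 * v <= 2 * exp (- (2 * a)) * (1 - cos (2 * t)) / den (exp (- (2 * a))) (2 * t)).
{ eapply Rle_trans; [|apply R2; lra]. apply Rmult_le_compat_r; [easy|]; nra. }
apply (Rmult_le_compat_l (/ a)) in M1; [|lra].
apply (Rmult_le_compat_l (/ (2 * a))) in M2; [|rewrite Rinv_mult; lra].
assert (0 <= / a * v) by (apply Rmult_le_pos; lra).
specialize (B1 (proj1 Ha)); assert (Ha2 : 0 < 2 * a) by lra; specialize (B2 Ha2).
rewrite Rinv_mult in M2, B2; unfold Rdiv at 1; lra.
Qed.

(** The term [m = 1] alone suffices: [2 e^{-a} (1 - cos t)] is at least its value at [t = 2a], about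
    [4 a^2] and bounded below by [3.88 a^2]. The surplus of [3.88/4.88] over 0.79, divided by [a],
    covers the truncation error. *)
Lemma decay_ge_far (a : R) (K : nat) (t : R) : 0 < a <= 0.029 -> (1 <= K)%nat -> negligible_tail a K ->
  2 * a <= t <= PI -> 0.79 / a <= decay a K t.
Proof.
intros Ha HK HT Ht; destruct (tail_terms a K Ha HK HT) as [T1 _].
generalize (bsum_rad_cos_ge a t K (proj1 Ha)) (ratio_ge a (3.88 * a ^ 2) t); intros B1 R1.
unfold decay.
generalize (bsum_rad_cos_nonneg (2 * a) (2 * t) K); intros N2.
assert (C : cos t <= cos (2 * a)) by (apply cos_decr_1; generalize PI2_3_2; lra).
assert (Q : 3.88 * a ^ 2 <= 2 * exp (- a) * (1 - cos t)).
{ generalize (cos_le_4 (2 * a)) (exp_ineq1_le (- a)); intros H1 H2.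
  assert (Ha2 : a ^ 2 <= 0.0009) by nra.
  assert (1.999 * a ^ 2 <= 1 - cos (2 * a)).
  { assert (0 <= a ^ 2 * (0.0009 - a ^ 2)) by (apply Rmult_le_pos; nra).
    assert (0 <= 2 * a) by lra; specialize (H1 H0); nra. }
  replace (2 * exp (- a) * (1 - cos t)) with (exp (- a) * (2 * (1 - cos t))) by ring.
  apply Rle_trans with (0.971 * (2 * (1.999 * a ^ 2))); [nra|].
  apply Rmult_le_compat; [lra | nra | lra | lra]. }
assert (R2 : 3.88 * a ^ 2 / (a ^ 2 + 3.88 * a ^ 2) <= 2 * exp (- a) * (1 - cos t) / den (exp (- a)) t)
  by (apply R1; [lra | nra]).
replace (3.88 * a ^ 2 / (a ^ 2 + 3.88 * a ^ 2)) with (3.88 / (1 + 3.88)) in R2 by (field; nra).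
assert (Hi : 34 <= / a).
{ replace 34 with (/ / 34) by field; apply Rinv_le_contravar; lra. }
apply (Rmult_le_compat_l (/ a)) in R2; [|lra].
unfold Rdiv in *; nra.
Qed.

(** The powers [m = 1, 2] give nearly [(1 + 1/4) / a^2]. At the saddle point this bounds [n] from
    below, which converts [eta n] into a multiple of [a^4]. *)
Lemma mean_size_ge (a : R) (K : nat) : 0 < a <= 0.029 -> (1 <= K)%nat -> negligible_tail a K ->
  1.2 / a ^ 2 <= mean_size a K.
Proof.
intros Ha HK HT.
assert (T : forall y, a <= y <= 0.06 -> rad y K <= rad a K ->
  (1 - y) / y ^ 2 - 0.003 <= bsum (fun k => INR k * rad y k) K).
{ intros y Hy Hra; generalize (bsum_id_rad_eq y K); cbn zeta; intros E.
  assert (Hy0 : 0 < y) by lra; specialize (E Hy0).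
  generalize (one_sub_exp_bounds y Hy0) (exp_neg_lt_1 y Hy0) (exp_ineq1_le (- y)); intros B Hx Hx'.
  set (x := exp (- y)) in *.
  assert (H1 : 0.97 * y <= 1 - x) by nra.
  assert (L : (1 - y) / y ^ 2 <= x / (1 - x) ^ 2).
  { apply Rmult_le_compat; [lra | | lra |].
    - left; apply Rinv_0_lt_compat, pow_lt; lra.
    - apply Rinv_le_contravar; [apply pow_lt; lra | apply pow_incr; lra]. }
  assert (I1 : / (1 - x) <= 1.04 / y).
  { apply Rle_trans with (/ (0.97 * y)); [apply Rinv_le_contravar; lra|].
    rewrite Rinv_mult; unfold Rdiv; apply Rmult_le_compat_r; [left; apply Rinv_0_lt_compat|]; lra. }
  assert (I0 : 0 < / (1 - x)) by (apply Rinv_0_lt_compat; lra).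
  assert (HKr : 1 <= INR K) by (apply (le_INR 1); easy).
  assert (P : x ^ K * (INR K + 1) <= y ^ 2 / 1000).
  { unfold negligible_tail in HT.
    assert (Ex : x ^ K = rad y K) by (symmetry; apply rad_eq_pow).
    rewrite Ex.
    assert (rad y K * (INR K + 1) <= (INR K + 1) * rad a K) by nra.
    nra. }
  assert (P0 : 0 <= x ^ K) by (apply pow_le; lra).
  assert (TT : x ^ S K * ((INR K + 1) / (1 - x) + x / (1 - x) ^ 2) <= 0.003).
  { replace (x ^ S K * _) with (x * (x ^ K * (INR K + 1)) * / (1 - x) + x * x * x ^ K * (/ (1 - x)) ^ 2)
      by (simpl; field; lra).
    assert (Q1 : x * (x ^ K * (INR K + 1)) <= y ^ 2 / 1000).
    { assert (0 <= x ^ K * (INR K + 1)) by nra; nra. }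
    assert (Q2 : x * x * x ^ K <= y ^ 2 / 1000).
    { assert (x ^ K <= x ^ K * (INR K + 1)) by nra; assert (x * x <= 1) by nra; nra. }
    assert (Q3 : x * (x ^ K * (INR K + 1)) * / (1 - x) <= y ^ 2 / 1000 * (1.04 / y)).
    { apply Rmult_le_compat; try lra. apply Rmult_le_pos; [lra | nra]. }
    assert (Q4 : x * x * x ^ K * (/ (1 - x)) ^ 2 <= y ^ 2 / 1000 * (1.04 / y) ^ 2).
    { apply Rmult_le_compat; try lra; [nra | apply pow_le; lra | apply pow_incr; lra]. }
    replace (y ^ 2 / 1000 * (1.04 / y)) with (1.04 / 1000 * y) in Q3 by (field; lra).
    replace (y ^ 2 / 1000 * (1.04 / y) ^ 2) with (1.04 ^ 2 / 1000) in Q4 by (field; lra).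
    lra. }
  lra. }
assert (S : bsum (fun k => INR k * rad a k + INR k * rad (2 * a) k) K <= mean_size a K).
{ apply bsum_le; intros k Hk; generalize (rad_bounds a k (proj1 Ha) Hk); intros Hr.
  rewrite rad_2, <- Rmult_plus_distr_l; apply Rmult_le_compat_l; [apply pos_INR|].
  set (r := rad a k) in *.
  replace (r / (1 - r)) with (r + r ^ 2 + r ^ 3 / (1 - r)) by (field; lra).
  assert (0 <= r ^ 3 / (1 - r)) by (apply Rdiv_le_0_compat; [apply pow_le|]; lra).
  lra. }
rewrite bsum_plus in S.
generalize (T a) (T (2 * a)); intros Ta Tb.
assert (rad (2 * a) K <= rad a K).
{ generalize (rad_bounds a K (proj1 Ha) HK); rewrite rad_2; nra. }
assert (Ta' : (1 - a) / a ^ 2 - 0.003 <= bsum (fun k => INR k * rad a k) K) by (apply Ta; lra).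
assert (Tb' : (1 - 2 * a) / (2 * a) ^ 2 - 0.003 <= bsum (fun k => INR k * rad (2 * a) k) K)
  by (apply Tb; lra).
assert (Hi : 1000 <= / a ^ 2).
{ replace 1000 with (/ / 1000) by field; apply Rinv_le_contravar; [apply pow_lt; lra | nra]. }
replace ((1 - 2 * a) / (2 * a) ^ 2) with ((1 - 2 * a) / 4 * / a ^ 2) in Tb' by (field; lra).
unfold Rdiv in *; nra.
Qed.

(** * The saddle point *)

Lemma INR_ge_2000 (n : nat) : (2000 <= n)%nat -> 2000 <= INR n.
Proof. intros Hn; replace 2000 with (INR 2000) by (rewrite INR_IZR_INZ; easy); now apply le_INR. Qed.

Lemma ex_derive_mean_size (K : nat) (a : R) : 0 < a -> ex_derive (fun a => mean_size a K) a.
Proof.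
intros Ha; unfold mean_size; induction K as [|K IH]; cbn [bsum].
- apply ex_derive_const.
- apply (ex_derive_plus (fun a => bsum (fun k => INR k * (rad a k / (1 - rad a k))) K)
    (fun a => INR (S K) * (rad a (S K) / (1 - rad a (S K))))); [easy|].
  assert (Hr : 0 < rad a (S K) < 1) by (apply rad_bounds; [easy | lia]).
  revert Hr; unfold rad; generalize (INR (S K)); intros k Hr.
  auto_derive; lra.
Qed.

(** Intermediate value theorem. At [a = 1/(n+1)] the parts of size 1 alone already contribute at
    least [n] to the mean. *)
Lemma saddle_exists (n K : nat) : (2000 <= n)%nat -> (1 <= K)%nat ->
  exists a, / (INR n + 1) <= a <= 0.029 /\ mean_size a K = INR n.
Proof.
intros Hn HK.
assert (Hn' := INR_ge_2000 n Hn).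
set (lo := / (INR n + 1)).
assert (Hlo : 0 < lo) by (apply Rinv_0_lt_compat; lra).
assert (Hlo' : lo < 0.029).
{ apply Rle_lt_trans with (/ 2000); [|lra]. apply Rinv_le_contravar; lra. }
assert (B1 : INR n <= mean_size lo K).
{ apply Rle_trans with (INR 1 * (rad lo 1 / (1 - rad lo 1))).
  - generalize (rad_bounds lo 1 Hlo (le_n 1)); intros Hr.
    assert (H1 : 1 - lo <= rad lo 1).
    { unfold rad; simpl; rewrite Rmult_1_r; apply (exp_ineq1_le (- lo)). }
    apply Rmult_le_reg_r with (1 - rad lo 1); [lra|].
    replace (INR 1 * (rad lo 1 / (1 - rad lo 1)) * (1 - rad lo 1)) with (rad lo 1) by (simpl; field; lra).
    assert ((INR n + 1) * lo = 1) by (unfold lo; field; lra).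
    nra.
  - clear - Hlo HK; unfold mean_size; induction HK as [|K HK IH]; cbn [bsum]; [lra|].
    assert (Hr : 0 < rad lo (S K) < 1) by (apply rad_bounds; [easy | lia]).
    assert (0 <= INR (S K) * (rad lo (S K) / (1 - rad lo (S K)))).
    { apply Rmult_le_pos; [apply pos_INR|]; apply Rdiv_le_0_compat; lra. }
    lra. }
(* The thresholds 2000 and 0.029 are matched here: [1.68 / 0.029^2 < 2000]. *)
assert (B2 : mean_size 0.029 K < INR n).
{ apply Rle_lt_trans with (1.68 / 0.029 ^ 2); [apply mean_size_le; lra|]. lra. }
destruct (Rle_lt_or_eq_dec _ _ B1) as [L|L].
2:{ exists lo; split; [lra | easy]. }
destruct (Ranalysis5.IVT_interv (fun a => INR n - mean_size a K) lo 0.029) as [a [Hl E]]; try lra.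
- intros a Ha; apply continuity_pt_minus; [apply continuity_pt_const; intros ? ?; easy|].
  apply continuity_pt_filterlim, (ex_derive_continuous (fun a => mean_size a K)), ex_derive_mean_size; lra.
- exists a; split; [easy | lra].
Qed.

(** Even with the crude bound [a >= 1/(n+1)], [a K] is at least [(n+1)^3], so that
    [exp z >= z^4 / 24] is enough. *)
Lemma negligible_tail_power (n : nat) (a : R) : (2000 <= n)%nat -> / (INR n + 1) <= a ->
  negligible_tail a (S n ^ 4).
Proof.
intros Hn Ha.
assert (Hn' := INR_ge_2000 n Hn).
unfold negligible_tail, rad.
assert (EK : INR (S n ^ 4) = (INR n + 1) ^ 4) by now rewrite pow_INR, S_INR.
rewrite EK; set (N := INR n + 1) in *.
assert (HN : 2001 <= N) by (unfold N; lra).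
assert (Ha0 : 0 < / N) by (apply Rinv_0_lt_compat; lra).
assert (HaN : 1 <= a * N).
{ apply (Rmult_le_compat_r N) in Ha; [|lra]. rewrite Rinv_l in Ha; lra. }
set (z := a * N ^ 4).
assert (Hz : 0 < z) by (apply Rmult_lt_0_compat; [lra | apply pow_lt; lra]).
generalize (exp_ge_4 z); intros E4.
assert (E5 : z ^ 4 / 24 <= exp z) by (assert (0 <= z ^ 2) by nra; assert (0 <= z ^ 3) by (apply pow_le; lra); lra).
assert (Hz4 : 0 < z ^ 4) by now apply pow_lt.
rewrite exp_Ropp.
apply Rle_trans with ((N ^ 4 + 1) * (24 / z ^ 4)).
{ apply Rmult_le_compat_l.
  - assert (0 <= N ^ 4) by (apply pow_le; lra); lra.
  - replace (24 / z ^ 4) with (/ (z ^ 4 / 24)) by (field; lra).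
    apply Rinv_le_contravar; [lra | easy]. }
assert (HN4 : 1 <= N ^ 4) by (apply pow_R1_Rle; lra).
apply Rle_trans with ((2 * N ^ 4) * (24 / z ^ 4)).
{ apply Rmult_le_compat_r; [apply Rdiv_le_0_compat; lra | lra]. }
assert (Hy : 2001 <= a ^ 2 * N ^ 4).
{ replace (a ^ 2 * N ^ 4) with ((a * N) ^ 2 * (N * N)) by ring.
  assert (1 <= (a * N) ^ 2) by (apply pow_R1_Rle; lra). nra. }
assert (HN0 : 0 < N ^ 4) by lra.
replace ((2 * N ^ 4) * (24 / z ^ 4)) with (48 * a ^ 2 / (a ^ 2 * N ^ 4) ^ 3) by (unfold z; field; lra).
assert (Hy3 : 48000 <= (a ^ 2 * N ^ 4) ^ 3).
{ apply Rle_trans with (2001 ^ 3); [lra | apply pow_incr; lra]. }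
apply Rle_trans with (48 * a ^ 2 / 48000).
- apply Rmult_le_compat_l; [nra|]; apply Rinv_le_contravar; lra.
- lra.
Qed.

Lemma exp_beats_power (a : R) : 0 < a <= 0.029 -> 120 * exp (- (0.79 / a)) <= a ^ 5.
Proof.
(* A tenth of the exponent: [e^{10u} >= (40 u)^5] follows from [e^{2u} >= 40 u], which holds for
   [u >= 2.72]. *)
intros Ha; set (u := 0.079 / a).
assert (Hu : 2.72 <= u).
{ unfold u; apply Rle_trans with (0.079 / 0.029); [lra|].
  apply Rmult_le_compat_l; [lra|]; apply Rinv_le_contravar; lra. }
generalize (exp_ge_4 u); intros E.
assert (E2 : 40 * u <= exp u ^ 2).
{ assert (L : 2.3 * u + 6.3 <= exp u).
  { assert (L2 : 7.3 + (u - 2.72) * 5.44 <= u ^ 2) by nra.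
    assert (L3 : 0 <= u ^ 3 - 20) by nra.
    assert (L4 : 0 <= u ^ 4 - 54) by nra.
    assert (0 <= u) by lra; specialize (E H); lra. }
  assert ((2.3 * u + 6.3) ^ 2 <= exp u ^ 2) by (apply pow_incr; lra).
  nra. }
assert (E3 : (40 * u) ^ 5 <= (exp u ^ 2) ^ 5) by (apply pow_incr; lra).
replace (exp (- (0.79 / a))) with (/ (exp u ^ 2) ^ 5).
2:{ rewrite exp_Ropp; f_equal.
    replace (0.79 / a) with (u + u + u + u + u + u + u + u + u + u).
    - rewrite !exp_plus; ring.
    - unfold u, Rdiv; lra. }
assert (Hi : 0 < / a) by (apply Rinv_0_lt_compat; lra).
assert (P : 0 < (40 * u) ^ 5) by (apply pow_lt; lra).
apply Rle_trans with (120 * / (40 * u) ^ 5).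
- apply Rmult_le_compat_l; [lra|]; apply Rinv_le_contravar; lra.
- replace (120 * / (40 * u) ^ 5) with (120 / (40 * 0.079) ^ 5 * a ^ 5).
  + assert (0 < a ^ 5) by (apply pow_lt; lra). nra.
  + unfold u; field; lra.
Qed.

(** * The integral *)

Definition saddle (n K : nat) (a : R) : Prop :=
  0 < a <= 0.029 /\ (1 <= K)%nat /\ negligible_tail a K /\ mean_size a K = INR n.

(* Chosen so that [(1 - eta n)^2 <= 1 - 1/n^2]. *)
Definition eta (n : nat) : R := 0.6 / INR n ^ 2.

Definition integrand (n K : nat) (a t : R) : R :=
  amp a K t * cos (arg a K t - INR n * t) * (1 - cos t - eta n).

Lemma continuous_integrand (n K : nat) (a t : R) : 0 < a -> continuous (integrand n K a) t.
Proof.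
intros Ha; apply (ex_derive_continuous (integrand n K a)); unfold integrand.
generalize (ex_derive_amp a K t Ha) (ex_derive_arg a K t Ha); intros.
auto_derive; easy.
Qed.

Lemma eta_bounds (n K : nat) (a : R) : saddle n K a -> 0 < eta n <= 5 / 12 * a ^ 4.
Proof.
intros (Ha & HK & HT & HM); unfold eta.
generalize (mean_size_ge a K Ha HK HT); rewrite HM; intros HN.
assert (H0 : 0 < 1.2 / a ^ 2) by (apply Rdiv_lt_0_compat; [lra | apply pow_lt; lra]).
split; [apply Rdiv_lt_0_compat; [lra | apply pow_lt; lra]|].
apply Rle_trans with (0.6 / (1.2 / a ^ 2) ^ 2).
- apply Rmult_le_compat_l; [lra|]; apply Rinv_le_contravar; [now apply pow_lt | apply pow_incr; lra].
- right; replace (0.6 / (1.2 / a ^ 2) ^ 2) with (0.6 / 1.2 ^ 2 * a ^ 4) by (field; lra); lra.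
Qed.

Lemma amp_le_0 (a : R) (K : nat) (t : R) : 0 < a -> amp a K t <= amp a K 0.
Proof.
intros Ha; generalize (amp_le a K t Ha) (amp_pos a K 0 Ha) (decay_nonneg a K t); intros H1 H2 H3.
assert (exp (- decay a K t) <= 1) by (rewrite <- exp_0; apply exp_le; lra).
nra.
Qed.

Lemma phase_bounds (n K : nat) (b c t : R) : saddle n K (b ^ 2) -> 0 < b -> 0 <= t <= c * b ^ 3 ->
  - (1.76 * c ^ 3 * b) <= arg (b ^ 2) K t - INR n * t <= 0.
Proof.
intros (Ha & HK & HT & HM) Hb Ht.
generalize (arg_bounds (b ^ 2) K t (proj1 Ha) (proj1 Ht)) (cumulant3_le (b ^ 2) K Ha); rewrite HM.
intros [A1 A2] C; split; [|easy].
assert (T3 : t ^ 3 <= (c * b ^ 3) ^ 3) by (apply pow_incr; lra).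
assert (T0 : 0 <= t ^ 3) by (apply pow_le; lra).
assert (P : 0 < / b ^ 8) by (apply Rinv_0_lt_compat, pow_lt; easy).
replace (10.56 / (b ^ 2) ^ 4) with (10.56 * / b ^ 8) in C by (field; lra).
assert (cumulant3 (b ^ 2) K * t ^ 3 <= 10.56 * / b ^ 8 * (c * b ^ 3) ^ 3).
{ apply Rle_trans with (10.56 * / b ^ 8 * t ^ 3).
  - apply Rmult_le_compat_r; lra.
  - apply Rmult_le_compat_l; lra. }
replace (10.56 * / b ^ 8 * (c * b ^ 3) ^ 3) with (10.56 * (c ^ 3 * b)) in H by (field; lra).
lra.
Qed.

Lemma sqrt_range (b : R) : 0 < b -> b ^ 2 <= 0.029 -> b <= 0.1703.
Proof. intros; nra. Qed.

Lemma one_sub_cos_ge (t : R) : 0 <= t <= 0.1 -> 0.499 * t ^ 2 <= 1 - cos t.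
Proof.
intros Ht; generalize (cos_le_4 t (proj1 Ht)).
assert (0 <= t ^ 2 <= 0.01) by nra.
assert (t ^ 4 = t ^ 2 * t ^ 2) by ring.
nra.
Qed.

(** On this range the phase is at most [1.76 * 0.1703] in size, so its cosine is at least 0.955. The
    Gaussian is replaced by its cubic Taylor polynomial, and the minorant has the explicit primitive
    [P]; the constant 0.4765 is just below [0.955 * 0.499]. *)
Lemma integral_central (n K : nat) (b : R) : saddle n K (b ^ 2) -> 0 < b ->
  0.0368 * amp (b ^ 2) K 0 * b ^ 9 <= RInt (integrand n K (b ^ 2)) 0 (b ^ 3).
Proof.
intros S Hb; assert (S' := S); destruct S' as (Ha & _).
assert (Hb' := sqrt_range b Hb (proj2 Ha)).
destruct (eta_bounds n K _ S) as [He1 He2]; set (e := eta n) in *.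
assert (HC := amp_pos (b ^ 2) K 0 (proj1 Ha)); set (C := amp (b ^ 2) K 0) in *.
assert (Hb3 : 0 < b ^ 3) by now apply pow_lt.
assert (Hb9 : 0 < b ^ 9) by now apply pow_lt.
set (P := fun t => C * (0.4765 * (t ^ 3 / 3 - 1.75 / b ^ 6 * (t ^ 5 / 5)
  + (1.75 / b ^ 6) ^ 2 / 2 * (t ^ 7 / 7) - (1.75 / b ^ 6) ^ 3 / 6 * (t ^ 9 / 9)) - e * t)).
apply Rle_trans with (P (b ^ 3) - P 0).
- unfold P.
  replace (_ - _) with (C * (0.4765 * (/ 3 - 1.75 / 5 + 1.75 ^ 2 / 2 / 7 - 1.75 ^ 3 / 6 / 9) * b ^ 9 - e * b ^ 3))
    by (field; lra).
  assert (e * b ^ 3 <= 0.0121 * b ^ 9).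
  { apply Rle_trans with (5 / 12 * (b ^ 2) ^ 4 * b ^ 3); [apply Rmult_le_compat_r; lra|].
    replace (5 / 12 * (b ^ 2) ^ 4 * b ^ 3) with (5 / 12 * b ^ 2 * b ^ 9) by ring.
    apply Rmult_le_compat_r; lra. }
  rewrite (Rmult_comm 0.0368), Rmult_assoc; apply Rmult_le_compat_l; [lra|].
  lra.
- apply (RInt_ge_primitive _ P (fun t => C * (0.4765 * t ^ 2 * (1 - 1.75 / b ^ 6 * t ^ 2
    + (1.75 / b ^ 6 * t ^ 2) ^ 2 / 2 - (1.75 / b ^ 6 * t ^ 2) ^ 3 / 6) - e))); [lra| | |].
  + intros t; apply continuous_integrand; lra.
  + intros t _; unfold P; auto_derive; [easy|]; field; lra.
  + intros t Ht; unfold integrand; fold e.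
    assert (Hth : 0 <= t <= 1 * b ^ 3) by lra.
    destruct (phase_bounds n K b 1 t S Hb Hth) as [F1 F2].
    set (ph := arg (b ^ 2) K t - INR n * t) in *.
    assert (F : 0.955 <= cos ph) by (generalize (cos_ge_2 ph); nra).
    assert (F' := proj2 (COS_bound ph)).
    generalize (amp_ge (b ^ 2) K t (proj1 Ha)) (amp_le_0 (b ^ 2) K t (proj1 Ha))
      (cumulant2_le (b ^ 2) K Ha); fold C; set (A := amp (b ^ 2) K t); intros A1 A2 CU.
    assert (Ht1 : t <= 0.1) by nra.
    assert (G := one_sub_cos_ge t (conj (proj1 Ht) Ht1)).
    set (X := 1.75 / b ^ 6 * t ^ 2).
    assert (HX : 0 <= X).
    { unfold X; apply Rmult_le_pos; [apply Rdiv_le_0_compat; [lra | now apply pow_lt] | nra]. }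
    assert (E : exp (- X) <= exp (- (cumulant2 (b ^ 2) K * t ^ 2 / 2))).
    { apply exp_le, Ropp_le_contravar; unfold X.
      apply Rle_trans with (3.5 / (b ^ 2) ^ 3 * t ^ 2 / 2).
      - assert (0 <= t ^ 2) by nra; nra.
      - right; replace (3.5 / (b ^ 2) ^ 3 * t ^ 2 / 2) with (3.5 / 2 / b ^ 6 * t ^ 2) by (field; lra).
        unfold Rdiv; lra. }
    generalize (exp_neg_ge_3 X HX) (exp_pos (- X)); intros E1 E2.
    set (q := 1 - X + X ^ 2 / 2 - X ^ 3 / 6) in *.
    assert (A3 : C * exp (- X) <= A).
    { eapply Rle_trans; [|exact A1]; apply Rmult_le_compat_l; lra. }
    assert (0 <= t ^ 2) by nra.
    assert (B1 : C * exp (- X) * (0.955 * (0.499 * t ^ 2)) <= A * (cos ph * (1 - cos t))).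
    { apply Rmult_le_compat; [nra | nra | easy |]. apply Rmult_le_compat; lra. }
    assert (B2 : C * (0.4765 * t ^ 2 * q) <= C * exp (- X) * (0.955 * (0.499 * t ^ 2))).
    { replace (C * exp (- X) * (0.955 * (0.499 * t ^ 2))) with (C * ((0.955 * 0.499 * t ^ 2) * exp (- X))) by ring.
      apply Rmult_le_compat_l; [lra|].
      apply Rle_trans with (0.4765 * t ^ 2 * exp (- X)); [apply Rmult_le_compat_l; lra|].
      apply Rmult_le_compat_r; lra. }
    assert (B3 : A * cos ph * e <= C * e).
    { apply Rmult_le_compat_r; [lra|]. assert (0 < A) by (apply amp_pos; lra). nra. }
    lra.
Qed.

(** From [t = b^3] on, [1 - cos t] is at least [0.499 a^3], which exceeds the bound [5/12 a^4] on
    [eta n]. *)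
Lemma integrand_factor_bounds (n K : nat) (b t : R) : saddle n K (b ^ 2) -> 0 < b ->
  b ^ 3 <= t <= PI -> 0 <= 1 - cos t - eta n <= 1 - cos t.
Proof.
intros S Hb Ht; assert (S' := S); destruct S' as (Ha & _).
assert (Hb' := sqrt_range b Hb (proj2 Ha)).
destruct (eta_bounds n K _ S) as [He1 He2].
split; [|lra].
assert (Hb3 : 0 < b ^ 3) by now apply pow_lt.
assert (Hb31 : b ^ 3 <= 0.1) by nra.
assert (G : 0.499 * (b ^ 3) ^ 2 <= 1 - cos (b ^ 3)) by (apply one_sub_cos_ge; lra).
assert (cos t <= cos (b ^ 3)) by (apply cos_decr_1; lra).
assert (5 / 12 * (b ^ 2) ^ 4 <= 0.499 * (b ^ 3) ^ 2).
{ replace ((b ^ 2) ^ 4) with (b ^ 2 * (b ^ 3) ^ 2) by ring.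
  assert (0 <= (b ^ 3) ^ 2) by nra. nra. }
lra.
Qed.

(** The limit 1.71 is as far as the phase bound keeps the cosine nonnegative:
    [1.76 * 1.71^3 * 0.1703] is just below [1.5 < pi/2]. *)
Lemma integral_middle (n K : nat) (b : R) : saddle n K (b ^ 2) -> 0 < b ->
  0 <= RInt (integrand n K (b ^ 2)) (b ^ 3) (1.71 * b ^ 3).
Proof.
intros S Hb; assert (S' := S); destruct S' as (Ha & _).
assert (Hb' := sqrt_range b Hb (proj2 Ha)).
assert (Hb3 : 0 < b ^ 3) by now apply pow_lt.
assert (Hb31 : b ^ 3 <= 0.1) by nra.
apply Rle_trans with ((fun _ => 0) (1.71 * b ^ 3) - (fun _ => 0) (b ^ 3)); [lra|].
apply (RInt_ge_primitive _ (fun _ => 0) (fun _ => 0)); [lra| | |].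
- intros t; apply continuous_integrand; lra.
- intros t _; auto_derive; easy.
- intros t Ht.
  assert (Hth : 0 <= t <= 1.71 * b ^ 3) by lra.
  destruct (phase_bounds n K b 1.71 t S Hb Hth) as [F1 F2].
  generalize PI2_3_2; intros.
  assert (0 <= cos (arg (b ^ 2) K t - INR n * t)) by (apply cos_ge_0; lra).
  generalize (integrand_factor_bounds n K b t S Hb) (amp_pos (b ^ 2) K t (proj1 Ha)); intros G A.
  unfold integrand; apply Rmult_le_pos; [apply Rmult_le_pos; lra|].
  apply G; lra.
Qed.

Lemma integrand_ge (n K : nat) (b t : R) : saddle n K (b ^ 2) -> 0 < b -> b ^ 3 <= t <= PI ->
  - (amp (b ^ 2) K 0 * exp (- decay (b ^ 2) K t) * (1 - cos t)) <= integrand n K (b ^ 2) t.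
Proof.
intros S Hb Ht; assert (S' := S); destruct S' as (Ha & _).
generalize (integrand_factor_bounds n K b t S Hb Ht) (amp_pos (b ^ 2) K t (proj1 Ha))
  (amp_le (b ^ 2) K t (proj1 Ha)) (COS_bound (arg (b ^ 2) K t - INR n * t)).
unfold integrand; set (A := amp (b ^ 2) K t); set (c := cos (_ - _)); set (f := 1 - cos t - eta n).
set (D := amp (b ^ 2) K 0 * exp (- decay (b ^ 2) K t)); intros G A0 A1 HC.
assert (A * f <= D * (1 - cos t)) by (apply Rmult_le_compat; lra).
assert (0 <= A * f) by (apply Rmult_le_pos; lra).
nra.
Qed.

(** The number 3.2345 lies just below the exponent [1.2 * 1.71^2 / (1 + 1.71^2 a)] at [a = 0.029],
    where the tail begins. Taking a tenth of it makes the quartic Taylor bound accurate enough. *)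
Lemma exp_neg_small : exp (- (3.2345)) <= / 25.3.
Proof.
rewrite exp_Ropp; apply Rinv_le_contravar; [lra|].
assert (E : 1.3817 <= exp 0.32345) by (eapply Rle_trans; [|apply exp_ge_4]; lra).
assert (E10 : 1.3817 ^ 10 <= exp 0.32345 ^ 10) by (apply pow_incr; lra).
replace (exp 3.2345) with (exp 0.32345 ^ 10); [lra|].
replace 3.2345 with (0.32345 + 0.32345 + 0.32345 + 0.32345 + 0.32345 + 0.32345 + 0.32345
  + 0.32345 + 0.32345 + 0.32345) by lra.
rewrite !exp_plus; ring.
Qed.

Lemma is_derive_mul_exp_neg (P g : R -> R) (t dP dg : R) :
  is_derive P t dP -> is_derive g t dg ->
  is_derive (fun t => P t * exp (- g t)) t ((dP - P t * dg) * exp (- g t)).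
Proof.
intros HP Hg; auto_derive.
- split; [now exists dP | split; [now exists dg | easy]].
- replace (Derive (fun x : R => P x) t) with dP by (symmetry; now apply is_derive_unique).
  replace (Derive (fun x : R => g x) t) with dg by (symmetry; now apply is_derive_unique).
  ring.
Qed.

(* [G' <= - t^2 e^{-g}] for [G = (40/27) t^2 / g' * e^{-g}] and [g = (1.2/a) t^2 / (a^2 + t^2)]. *)
Lemma integral_tail (n K : nat) (b : R) : saddle n K (b ^ 2) -> 0 < b ->
  - (0.0247 * amp (b ^ 2) K 0 * b ^ 9) <= RInt (integrand n K (b ^ 2)) (1.71 * b ^ 3) (2 * b ^ 2).
Proof.
intros S Hb; assert (S' := S); destruct S' as (Ha & HK & HT & _).
assert (Hb' := sqrt_range b Hb (proj2 Ha)).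
assert (HC := amp_pos (b ^ 2) K 0 (proj1 Ha)); set (C := amp (b ^ 2) K 0) in *.
assert (Hb3 : 0 < b ^ 3) by now apply pow_lt.
assert (Hb9 : 0 < b ^ 9) by now apply pow_lt.
set (a := b ^ 2) in *.
set (g := fun t => 1.2 / a * (t ^ 2 / (a ^ 2 + t ^ 2))).
(* As in Laplace's method, [t^2 e^{-g}] has approximate primitive [-(t^2 / g') e^{-g}], where
   [g' = 2.4 a t / (a^2 + t^2)^2]. *)
set (G := fun t => 40 / 27 * (t * (a ^ 2 + t ^ 2) ^ 2 / ((2 * 1.2) * a)) * exp (- g t)).
assert (Hab : 1.71 * b ^ 3 <= 2 * a) by (unfold a; nra).
assert (G2 : 0 <= G (2 * a)).
{ unfold G; apply Rmult_le_pos; [|left; apply exp_pos].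
  apply Rmult_le_pos; [lra|]; apply Rdiv_le_0_compat; [|lra].
  apply Rmult_le_pos; [lra | nra]. }
assert (G1 : G (1.71 * b ^ 3) <= 0.0492 * b ^ 9).
{ unfold G, g.
  replace (40 / 27 * (1.71 * b ^ 3 * (a ^ 2 + (1.71 * b ^ 3) ^ 2) ^ 2 / ((2 * 1.2) * a))) with
    (40 / 27 * 1.71 / (2 * 1.2) * (1 + 1.71 ^ 2 * a) ^ 2 * b ^ 9) by (unfold a; field; lra).
  replace (1.2 / a * ((1.71 * b ^ 3) ^ 2 / (a ^ 2 + (1.71 * b ^ 3) ^ 2))) with
    (1.2 * 1.71 ^ 2 / (1 + 1.71 ^ 2 * a)).
  2:{ unfold a; field; repeat split; try lra; assert (0 < b ^ 2) by (unfold a in Ha; lra);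
      assert (0 < b ^ 4) by (apply pow_lt; lra); nra. }
  assert (E1 : exp (- (1.2 * 1.71 ^ 2 / (1 + 1.71 ^ 2 * a))) <= / 25.3).
  { apply Rle_trans with (exp (- (3.2345))); [|exact exp_neg_small].
    apply exp_le, Ropp_le_contravar.
    apply Rmult_le_reg_r with (1 + 1.71 ^ 2 * a); [lra|].
    replace (1.2 * 1.71 ^ 2 / (1 + 1.71 ^ 2 * a) * (1 + 1.71 ^ 2 * a)) with (1.2 * 1.71 ^ 2) by (field; lra).
    lra. }
  assert (E2 : (1 + 1.71 ^ 2 * a) ^ 2 <= 1.1769) by nra.
  generalize (exp_pos (- (1.2 * 1.71 ^ 2 / (1 + 1.71 ^ 2 * a)))).
  set (E := exp _) in *; intros E0.
  apply Rle_trans with (40 / 27 * 1.71 / (2 * 1.2) * 1.1769 * b ^ 9 * / 25.3); [|lra].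
  apply Rmult_le_compat; [|lra| |easy].
  - apply Rmult_le_pos; [|lra]. apply Rmult_le_pos; [lra | nra].
  - apply Rmult_le_compat_r; [lra|]. apply Rmult_le_compat_l; lra. }
apply Rle_trans with (0.502 * C * G (2 * a) - 0.502 * C * G (1.71 * b ^ 3)).
{ assert (0 <= C * G (2 * a)) by (apply Rmult_le_pos; lra).
  assert (C * G (1.71 * b ^ 3) <= C * (0.0492 * b ^ 9)) by (apply Rmult_le_compat_l; lra).
  assert (0 < C * b ^ 9) by now apply Rmult_lt_0_compat.
  lra. }
apply (RInt_ge_primitive _ (fun t => 0.502 * C * G t)
  (fun t => 0.502 * C * (40 / 27 * (((a ^ 2 + t ^ 2) * (a ^ 2 + 5 * t ^ 2)) / ((2 * 1.2) * a) - t ^ 2) * exp (- g t))));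
  [easy| | |].
- intros t; apply continuous_integrand; lra.
- intros t _; assert (Hq : 0 < a ^ 2 + t ^ 2) by nra.
  assert (Dg : is_derive g t (2 * 1.2 * a * t / (a ^ 2 + t ^ 2) ^ 2)).
  { unfold g; auto_derive; [simpl in *; lra|]; field; lra. }
  assert (DP : is_derive (fun t => 40 / 27 * (t * (a ^ 2 + t ^ 2) ^ 2 / (2 * 1.2 * a))) t
    (40 / 27 * ((a ^ 2 + t ^ 2) * (a ^ 2 + 5 * t ^ 2)) / (2 * 1.2 * a))).
  { auto_derive; [easy|]; field; lra. }
  generalize (is_derive_scal _ _ (0.502 * C) _ (is_derive_mul_exp_neg _ _ _ _ _ DP Dg)).
  match goal with |- is_derive _ _ ?l -> is_derive _ _ ?r => replace l with r; [easy|] end.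
  apply Rmult_eq_compat_l, Rmult_eq_compat_r.
  field; lra.
- intros t Ht.
  assert (HP : 3 / 2 < PI / 2) by exact PI2_3_2.
  assert (Ht' : b ^ 3 <= t <= PI) by lra.
  eapply Rle_trans; [|apply (integrand_ge n K b t S Hb Ht')]; fold a C.
  assert (D : 1.2 / a * (t ^ 2 / (a ^ 2 + t ^ 2)) - 0.002 <= decay a K t)
    by (apply decay_ge_near; try easy; lra).
  fold (g t) in D.
  assert (E : exp (- decay a K t) <= 1.004 * exp (- g t)).
  { apply Rle_trans with (exp (0.002 + - g t)); [apply exp_le; lra|].
    rewrite exp_plus; apply Rmult_le_compat_r; [left; apply exp_pos|].
    generalize (exp_ineq1_le (- (0.002))) (exp_pos 0.002); intros H1 H2.
    assert (exp 0.002 * exp (- (0.002)) = 1) by (rewrite <- exp_plus, Rplus_opp_r; apply exp_0).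
    nra. }
  assert (F : 0 <= 1 - cos t <= t ^ 2 / 2) by (generalize (cos_ge_2 t) (COS_bound t); lra).
  assert (B : C * exp (- decay a K t) * (1 - cos t) <= C * (1.004 * exp (- g t)) * (t ^ 2 / 2)).
  { apply Rmult_le_compat; [|lra| |lra].
    - apply Rmult_le_pos; [lra | left; apply exp_pos].
    - apply Rmult_le_compat_l; lra. }
  (* The left side is the derivative of [t^2 / g'], the error of the approximate primitive. The
     factor [40/27 = 1 / (1 - 0.325)] in [G] compensates for it. *)
  assert (Q : (a ^ 2 + t ^ 2) * (a ^ 2 + 5 * t ^ 2) / ((2 * 1.2) * a) <= 0.325 * t ^ 2).
  { set (v := t ^ 2 / a ^ 2).
    assert (Ea : t ^ 2 = v * a ^ 2) by (unfold v; field; lra).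
    assert (Hv1 : 2.924 * a <= v).
    { apply Rmult_le_reg_r with (a ^ 2); [nra|]; rewrite <- Ea.
      assert ((1.71 * b ^ 3) ^ 2 <= t ^ 2) by (apply pow_incr; lra).
      replace (2.924 * a * a ^ 2) with (2.924 * (b ^ 3) ^ 2) by (unfold a; ring).
      assert (0 < (b ^ 3) ^ 2) by now apply pow_lt. lra. }
    assert (Hv2 : v <= 4).
    { apply Rmult_le_reg_r with (a ^ 2); [nra|]; rewrite <- Ea.
      assert (t ^ 2 <= (2 * a) ^ 2) by (apply pow_incr; lra). lra. }
    rewrite Ea.
    replace ((a ^ 2 + v * a ^ 2) * (a ^ 2 + 5 * (v * a ^ 2)) / ((2 * 1.2) * a)) with
      (a * (1 + v) * (1 + 5 * v) / (2 * 1.2) * a ^ 2) by (field; lra).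
    rewrite <- Rmult_assoc; apply Rmult_le_compat_r; [nra|].
    (* The inequality to prove is convex in [v], so [v^2] is replaced by its chord over
       [[2.924 a, 4]]. What remains is linear in [v], with constant term [a (1 - 58.48 a)] whose
       sign decides the case below. *)
    assert (0 <= (v - 2.924 * a) * (4 - v)) by (apply Rmult_le_pos; lra).
    enough (a + 6 * a * v + 5 * a * v ^ 2 <= 0.78 * v) by nra.
    assert (5 * a * v ^ 2 <= 5 * a * ((4 + 2.924 * a) * v - 11.696 * a)) by (apply Rmult_le_compat_l; lra).
    assert (M1 : 0 <= (0.029 - a) * v) by (apply Rmult_le_pos; lra).
    assert (M2 : 0 <= (0.029 - a) * (a * v)) by (apply Rmult_le_pos; nra).
    destruct (Rle_dec (1 - 58.48 * a) 0).
    - assert (0 <= a * (58.48 * a - 1)) by (apply Rmult_le_pos; lra); lra.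
    - assert (0 <= (v - 2.924 * a) * (1 - 58.48 * a)) by (apply Rmult_le_pos; lra); lra. }
  generalize (exp_pos (- g t)); intros E0.
  assert (CE : 0 < C * exp (- g t)) by now apply Rmult_lt_0_compat.
  set (Y := (a ^ 2 + t ^ 2) * (a ^ 2 + 5 * t ^ 2) / ((2 * 1.2) * a)) in *.
  apply Rle_trans with (- (C * (1.004 * exp (- g t)) * (t ^ 2 / 2))); [|lra].
  replace (0.502 * C * (40 / 27 * (Y - t ^ 2) * exp (- g t))) with
    (C * exp (- g t) * (0.502 * (40 / 27 * (Y - t ^ 2)))) by ring.
  replace (- (C * (1.004 * exp (- g t)) * (t ^ 2 / 2))) with
    (C * exp (- g t) * (- (1.004 * (t ^ 2 / 2)))) by ring.
  apply Rmult_le_compat_l; lra.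
Qed.

(** Here the integrand is bounded by the constant [m], the interval has length at most 4, and
    [exp_beats_power] makes [m] of order [b^10], one factor of [b <= 0.17033] better than the
    unit. *)
Lemma integral_far (n K : nat) (b : R) : saddle n K (b ^ 2) -> 0 < b ->
  - (0.0119 * amp (b ^ 2) K 0 * b ^ 9) <= RInt (integrand n K (b ^ 2)) (2 * b ^ 2) PI.
Proof.
intros S Hb; assert (S' := S); destruct S' as (Ha & HK & HT & _).
assert (Hb' := sqrt_range b Hb (proj2 Ha)).
assert (HC := amp_pos (b ^ 2) K 0 (proj1 Ha)); set (C := amp (b ^ 2) K 0) in *.
assert (HP : 3 / 2 < PI / 2) by exact PI2_3_2.
assert (HP4 := PI_4).
set (m := 2 * C * exp (- (0.79 / b ^ 2))).
assert (Hm : 0 < m) by (unfold m; generalize (exp_pos (- (0.79 / b ^ 2))); intros; nra).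
apply Rle_trans with ((fun t => - m * t) PI - (fun t => - m * t) (2 * b ^ 2)).
- assert (Hb9 : 0 < b ^ 9) by now apply pow_lt.
  assert (E : m <= 2 * C * (0.17033 / 120 * b ^ 9)).
  { unfold m; apply Rmult_le_compat_l; [lra|].
    generalize (exp_beats_power (b ^ 2) Ha).
    replace ((b ^ 2) ^ 5) with (b * b ^ 9) by ring; intros.
    assert (b * b ^ 9 <= 0.17033 * b ^ 9) by (apply Rmult_le_compat_r; lra). lra. }
  assert (0 < C * b ^ 9) by now apply Rmult_lt_0_compat.
  assert (m * (PI - 2 * b ^ 2) <= m * 4) by (apply Rmult_le_compat_l; lra).
  lra.
- apply (RInt_ge_primitive _ (fun t => - m * t) (fun t => - m)); [lra| | |].
  + intros t; apply continuous_integrand; lra.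
  + intros t _; auto_derive; [easy | ring].
  + intros t Ht.
    assert (Ht' : b ^ 3 <= t <= PI) by nra.
    eapply Rle_trans; [|apply (integrand_ge n K b t S Hb Ht')]; fold C.
    apply Ropp_le_contravar; unfold m.
    assert (D : 0.79 / b ^ 2 <= decay (b ^ 2) K t) by (apply decay_ge_far; easy).
    assert (E : exp (- decay (b ^ 2) K t) <= exp (- (0.79 / b ^ 2))) by (apply exp_le; lra).
    generalize (COS_bound t) (exp_pos (- decay (b ^ 2) K t)); intros B E0.
    replace (2 * C * exp (- (0.79 / b ^ 2))) with (C * exp (- (0.79 / b ^ 2)) * 2) by ring.
    apply Rmult_le_compat; [nra | lra | | lra].
    apply Rmult_le_compat_l; lra.
Qed.

(** The four pieces balance narrowly: [0.0368 + 0 - 0.0247 - 0.0119 > 0]. *)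
Lemma integral_nonneg (n K : nat) (a : R) : saddle n K a -> 0 <= RInt (integrand n K a) 0 PI.
Proof.
intros S; assert (S' := S); destruct S' as (Ha & _).
set (b := sqrt a).
assert (Hb : 0 < b) by (apply sqrt_lt_R0; lra).
assert (E : a = b ^ 2) by (unfold b; rewrite pow2_sqrt; lra).
rewrite E in *; clearbody b; clear E a.
assert (I : forall u v, ex_RInt (integrand n K (b ^ 2)) u v).
{ intros; apply (ex_RInt_continuous (V := R_CompleteNormedModule)); intros.
  apply continuous_integrand; lra. }
generalize (integral_central n K b S Hb) (integral_middle n K b S Hb)
  (integral_tail n K b S Hb) (integral_far n K b S Hb).
generalize (RInt_Chasles _ _ _ _ (I 0 (b ^ 3)) (I (b ^ 3) PI))
  (RInt_Chasles _ _ _ _ (I (b ^ 3) (1.71 * b ^ 3)) (I (1.71 * b ^ 3) PI))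
  (RInt_Chasles _ _ _ _ (I (1.71 * b ^ 3) (2 * b ^ 2)) (I (2 * b ^ 2) PI)).
unfold plus; simpl; intros E1 E2 E3 H1 H2 H3 H4.
simpl in *.
assert (0 < amp (b ^ 2) K 0 * b ^ 9) by (apply Rmult_lt_0_compat; [apply amp_pos; simpl in *; lra | now apply pow_lt]).
simpl in *; lra.
Qed.

(** Multiplication by [cos t] averages the coefficients at the two neighbouring indices. *)
Lemma RInt_integrand (n K : nat) (a : R) : 0 < a ->
  RInt (integrand n K a) 0 PI =
  (1 - eta n) * fourier a K (Z.of_nat n)
  - / 2 * (fourier a K (Z.of_nat n - 1) + fourier a K (Z.of_nat n + 1)).
Proof.
intros Ha; unfold fourier.
assert (I : forall y, ex_RInt (fun t => amp a K t * cos (arg a K t - y * t)) 0 PI)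
  by (intros; now apply ex_RInt_amp_cos).
symmetry; apply eq_sym, (is_RInt_unique (V := R_CompleteNormedModule)).
apply (is_RInt_ext (fun t => minus
  (scal (1 - eta n) (amp a K t * cos (arg a K t - IZR (Z.of_nat n) * t)))
  (scal (/ 2) (plus (amp a K t * cos (arg a K t - IZR (Z.of_nat n - 1) * t))
                    (amp a K t * cos (arg a K t - IZR (Z.of_nat n + 1) * t)))))).
- intros t _; unfold integrand; rewrite minus_IZR, plus_IZR, <- INR_IZR_INZ.
  unfold minus, plus, opp, scal; simpl; unfold mult; simpl.
  replace (arg a K t - (INR n - 1) * t) with ((arg a K t - INR n * t) + t) by ring.
  replace (arg a K t - (INR n + 1) * t) with ((arg a K t - INR n * t) - t) by ring.
  set (u := arg a K t - INR n * t); rewrite cos_plus, cos_minus; field.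
- apply (is_RInt_minus (V := R_NormedModule)); apply (is_RInt_scal (V := R_NormedModule)).
  + apply (RInt_correct (V := R_CompleteNormedModule)), I.
  + apply (is_RInt_plus (V := R_NormedModule));
      apply (RInt_correct (V := R_CompleteNormedModule)), I.
Qed.

Lemma partition_rec_log_concave (p : nat -> nat -> R) (n : nat) : partition_rec p ->
  (2000 <= n)%nat ->
  (forall m, 0 <= p (S n ^ 4)%nat m) ->
  INR n ^ 2 * (p (S n ^ 4)%nat (n - 1)%nat * p (S n ^ 4)%nat (n + 1)%nat)
  <= (INR n ^ 2 - 1) * p (S n ^ 4)%nat n ^ 2.
Proof.
intros Hp Hn Hpos.
set (K := (S n ^ 4)%nat) in *.
assert (HK : (1 <= K)%nat).
{ change 1%nat with (1 ^ 4)%nat; apply Nat.pow_le_mono_l; lia. }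
destruct (saddle_exists n K Hn HK) as (a & [Ha1 Ha2] & HM).
assert (Hn' := INR_ge_2000 n Hn).
assert (Ha : 0 < a).
{ eapply Rlt_le_trans; [|exact Ha1]; apply Rinv_0_lt_compat; lra. }
assert (S : saddle n K a).
{ repeat split; try easy. now apply negligible_tail_power. }
generalize (integral_nonneg n K a S); rewrite RInt_integrand by easy.
destruct (fourier_neg_pos a p K Ha Hp) as [_ F].
replace (Z.of_nat n - 1)%Z with (Z.of_nat (n - 1)) by lia.
replace (Z.of_nat n + 1)%Z with (Z.of_nat (n + 1)) by lia.
rewrite !F, minus_INR, plus_INR by lia.
set (p1 := p K (n - 1)%nat); set (p2 := p K (n + 1)%nat); set (p0 := p K n).
assert (H0 : 0 <= p0) by apply Hpos.
assert (H1 : 0 <= p1) by apply Hpos.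
assert (H2 : 0 <= p2) by apply Hpos.
replace (- (a * (INR n - INR 1))) with (- (a * INR n) + a) by (simpl; ring).
replace (- (a * (INR n + INR 1))) with (- (a * INR n) + - a) by (simpl; ring).
rewrite !exp_plus.
assert (Ee : exp a * exp (- a) = 1) by (rewrite <- exp_plus, Rplus_opp_r; apply exp_0).
generalize (exp_pos (- (a * INR n))) (exp_pos a) (exp_pos (- a)) PI_RGT_0.
set (E := exp (- (a * INR n))); set (x := exp a) in *; set (y := exp (- a)) in *.
intros HE Hx Hy HPi I.
assert (J : (x * p1 + y * p2) / 2 <= (1 - eta n) * p0).
{ apply Rmult_le_reg_l with (PI * E); [now apply Rmult_lt_0_compat | lra]. }
assert (Hxy : (x * p1) * (y * p2) = p1 * p2).
{ replace ((x * p1) * (y * p2)) with ((x * y) * (p1 * p2)) by ring; rewrite Ee; ring. }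
assert (G : p1 * p2 <= ((1 - eta n) * p0) ^ 2).
{ rewrite <- Hxy.
  apply Rle_trans with (((x * p1 + y * p2) / 2) ^ 2).
  - generalize (pow2_ge_0 (x * p1 - y * p2)); lra.
  - apply pow_incr; split; [|easy].
    assert (0 <= x * p1) by (apply Rmult_le_pos; lra).
    assert (0 <= y * p2) by (apply Rmult_le_pos; lra).
    lra. }
assert (HN : 0 < INR n ^ 2) by (apply pow_lt; lra).
apply Rle_trans with (INR n ^ 2 * ((1 - eta n) * p0) ^ 2); [apply Rmult_le_compat_l; lra|].
rewrite Rpow_mult_distr, <- Rmult_assoc; apply Rmult_le_compat_r; [apply pow2_ge_0|].
(* Thus [n^2 (1 - eta)^2 = n^2 - 1.2 + 0.6 eta], which is at most [n^2 - 1] for small [eta]. *)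
assert (He : INR n ^ 2 * eta n = 0.6) by (unfold eta; field; lra).
assert (0 < eta n) by (unfold eta; apply Rdiv_lt_0_compat; lra).
assert (eta n <= 0.1).
{ assert (4 <= INR n ^ 2) by nra. nra. }
replace (INR n ^ 2 * (1 - eta n) ^ 2) with (INR n ^ 2 - 2 * (INR n ^ 2 * eta n) + (INR n ^ 2 * eta n) * eta n) by ring.
rewrite He; lra.
Qed.

(** * Counting and computing partitions *)

Local Close Scope R_scope.

From mathcomp Require Import all_boot all_algebra.
From mathcomp Require Import zify.
Import GRing.Theory Num.Theory.

(** Partitions of [n] into parts at most [K], split by the multiplicity [j] of the largest allowed
    part, so that the recursion is structural in [K]. *)
Fixpoint parts (K n : nat) : nat :=
  if K is K'.+1 then \sum_(j < (n %/ K'.+1).+1) parts K' (n - j * K'.+1) else n == 0.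

Lemma parts_rec (K n : nat) :
  parts K.+1 n = parts K n + (if K < n then parts K.+1 (n - K.+1) else 0).
Proof.
rewrite [LHS]/= big_ord_recl mul0n subn0; congr (_ + _).
case: ltnP => H; last by rewrite divn_small // big_ord0.
have -> : n %/ K.+1 = ((n - K.+1) %/ K.+1).+1.
  by rewrite -[in LHS](subnK H) divnDr ?dvdnn // divnn addn1.
rewrite [RHS]/=; apply: eq_bigr => j _.
by rewrite lift0 mulSn subnDA.
Qed.

Arguments parts : simpl never.

Lemma parts_stable (K n : nat) : n <= K -> parts K n = parts n n.
Proof.
move=> /subnKC <-; elim: (K - n) => [|d IH]; first by rewrite addn0.
by rewrite addnS parts_rec IH ltnNge leq_addr addn0.
Qed.

Local Open Scope ring_scope.

(** A polynomial standing for [1 / (1 - X^k)]. The range [j <= m] is that of a multiplicity in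
    [partition_count m], and for [k >= 1] the cut does not affect coefficients up to [m]. *)
Definition geo (m k : nat) : {poly int} := \sum_(j < m.+1) 'X^(k * j).

Lemma coef_geo (m k : nat) (H : {poly int}) (n : nat) : (0 < k)%N -> (n <= m)%N ->
  (geo m k * H)`_n = H`_n + (if (k <= n)%N then (geo m k * H)`_(n - k) else 0).
Proof.
move=> k0 nm.
have E : geo m k = 1 + 'X^k * geo m k - 'X^(k * m.+1).
  rewrite /geo mulr_sumr [LHS]big_ord_recl muln0 expr0 -!addrA; congr (_ + _).
  rewrite big_ord_recr /= -exprD -mulnS addrK.
  by apply: eq_bigr => j _; rewrite /bump leq0n add1n mulnS exprD.
rewrite {1}E !(mulrBl, mulrDl) mul1r coefB coefD -mulrA !coefXnM.
have -> : (n < k * m.+1)%N by nia.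
by rewrite subr0 ltnNge; case: leqP.
Qed.

Lemma coef_prod_geo (m K n : nat) : (n <= m)%N ->
  (\prod_(i < K) geo m i.+1)`_n = (parts K n)%:R.
Proof.
elim: K n => [|K IHK] n nm.
  by rewrite big_ord0 coef1.
elim/ltn_ind: n nm => n IHn nm.
rewrite big_ord_recr /= mulrC coef_geo // IHK // parts_rec natrD; congr (_ + _).
case: ltnP => // Kn; rewrite -IHn ?big_ord_recr /= 1?mulrC //; lia.
Qed.

(** Expanding the product of sums over all choices of exponents gives one monomial per multiplicity
    function, of degree the sum of its parts; the coefficient of [X^n] counts the functions in
    [partition_count]. *)
Lemma partition_countE (n : nat) : partition_count n = parts n n.
Proof.
apply/eqP; rewrite -(eqr_nat int) -(@coef_prod_geo n) // /geo; apply/eqP.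
rewrite bigA_distr_bigA coef_sum /partition_count -sum1dep_card natr_sum big_mkcond /=.
apply: eq_bigr => f _.
rewrite (eq_bigr (fun i : 'I_n => 'X ^+ (i.+1 * f i))) // prodrXr coefXn eq_sym.
by case: eqP.
Qed.

(** * An efficient table of partition numbers *)

Fixpoint zipadd (old prev acc : seq N) : seq N * seq N :=
  match prev, old with
  | p :: prev', o :: old' => zipadd old' prev' (N.add o p :: acc)
  | _, _ => (rev acc, old)
  end.

(** Division by [1 - x^k] means [c_n = old_n + c_{n-k}], so each output block is the input block
    plus the preceding output block [prev], initially zeros. Blocks are nonempty, so the length of
    the input is enough fuel. *)
Fixpoint divgo (fuel : nat) (old prev : seq N) : seq N :=
  if fuel is f.+1 then
    if old is [::] then [::] else
      let: (c, rest) := zipadd old prev [::] in c ++ divgo f rest c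
  else [::].

(* Coefficients of [old / (1 - x^k)], computed block by block of length [k]. *)
Definition divgeo (k : nat) (old : seq N) : seq N := divgo (size old) old (nseq k 0%num).

Fixpoint divall (k : nat) (l : seq N) : seq N :=
  if k is k'.+1 then divall k' (divgeo k l) else l.

Definition table (n : nat) : seq N := divall n (1%num :: nseq n 0%num).

Local Close Scope ring_scope.
Local Notation nthN l i := (N.to_nat (nth 0%num l i)).

Lemma zipaddE (old prev acc : seq N) :
  zipadd old prev acc = (rev acc ++ [seq N.add x.1 x.2 | x <- zip old prev], drop (size prev) old).
Proof.
elim: prev old acc => [|p prev IH] [|o old] acc /=; rewrite ?cats0 //.
by rewrite IH rev_cons cat_rcons.
Qed.

Lemma divgoP (fuel : nat) (old prev : seq N) : size old <= fuel -> 0 < size prev ->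
  size (divgo fuel old prev) = size old /\
  forall n, n < size old -> nthN (divgo fuel old prev) n = nthN old n +
    (if n < size prev then nthN prev n else nthN (divgo fuel old prev) (n - size prev)).
Proof.
elim: fuel old prev => [|f IH] [|o old] prev // Hs Hp.
have -> : divgo f.+1 (o :: old) prev =
  let: (c, rest) := zipadd (o :: old) prev [::] in c ++ divgo f rest c by [].
rewrite zipaddE cat0s; move: (o :: old) Hs => {o}old Hs.
set c := map _ _; set rest := drop _ _; set k := size prev in Hp *.
have sc : size c = minn (size old) k by rewrite size_map size_zip.
have nc n : n < size old -> n < k -> nthN c n = nthN old n + nthN prev n.
  move=> H1 H2; rewrite (nth_map (0%num, 0%num)) ?size_zip ?leq_min ?H1 //.
  by rewrite nth_zip_cond size_zip leq_min H1 H2 N2Nat.inj_add.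
have [sk|ks] := leqP (size old) k.
  have -> : rest = [::] by apply: drop_oversize.
  have -> : divgo f [::] c = [::] by case: (f).
  rewrite cats0 sc (minn_idPl sk); split=> // n Hn.
  by rewrite nc // (leq_trans Hn sk).
have {}sc : size c = k by rewrite sc; apply/minn_idPr/ltnW.
have sr : size rest = size old - k by rewrite size_drop.
have Hf : size rest <= f by lia.
have Hc : 0 < size c by rewrite sc.
have [S1 S2] := IH rest c Hf Hc.
rewrite size_cat S1 sc sr; split; first lia.
move=> n Hn; rewrite !nth_cat sc.
case: ltnP => nk; first exact: nc.
rewrite S2 ?sr; last lia.
rewrite sc nth_drop subnKC //; congr (_ + _).
by rewrite -subnDA; case: ltnP.
Qed.

Definition represents (m : nat) (l : seq N) (H : {poly int}) : Prop :=
  size l = m.+1 /\ forall n, n <= m -> (H`_n = (nthN l n)%:R)%R.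

Lemma represents_divgeo (m k : nat) (l : seq N) (H : {poly int}) : 0 < k ->
  represents m l H -> represents m (divgeo k l) (geo m k * H)%R.
Proof.
move=> k0 [sl nl].
have [|S1 S2] := @divgoP (size l) l (nseq k 0%num) (leqnn _) _; first by rewrite size_nseq.
rewrite size_nseq in S2; split; first by rewrite S1.
elim/ltn_ind => n IHn nm.
rewrite coef_geo // nl // S2 ?sl // natrD; congr (_ + _)%R.
case: leqP => kn; first by rewrite -sl; apply: IHn; lia.
by rewrite nth_nseq kn.
Qed.

Lemma represents_divall (m k : nat) (l : seq N) (H : {poly int}) :
  represents m l H -> represents m (divall k l) ((\prod_(i < k) geo m i.+1) * H)%R.
Proof.
elim: k l H => [|k IH] l H R; first by rewrite big_ord0 mul1r.
by rewrite big_ord_recr /= -mulrA; apply/IH/represents_divgeo.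
Qed.

Lemma represents_table (m : nat) : represents m (table m) (\prod_(i < m) geo m i.+1)%R.
Proof.
rewrite -[X in represents _ _ X]mulr1; apply: represents_divall.
split=> [|i im] /=; first by rewrite size_nseq.
by rewrite coef1; case: i im => [|i] //= im; rewrite nth_nseq; case: ifP.
Qed.

Lemma size_table (m : nat) : size (table m) = m.+1.
Proof. by have [] := represents_table m. Qed.

Lemma nth_table (m n : nat) : n <= m -> nthN (table m) n = partition_count n.
Proof.
move=> nm.
have [_ /(_ n nm)] := represents_table m.
rewrite coef_prod_geo // parts_stable // -partition_countE => /eqP.
by rewrite eqr_nat => /eqP.
Qed.

(** * The finite check *)

Definition log_concave_at (n a b c : N) : bool :=
  N.leb (N.mul (N.mul n n) (N.mul a c)) (N.mul (N.pred (N.mul n n)) (N.mul b b)).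

(* Large entries are rounded to about 40 bits, in the unfavourable direction. *)
Definition log_concave_test (n a b c : N) : bool :=
  let s := N.sub (N.size a) 40 in
  if N.eqb s 0 then log_concave_at n a b c else
  log_concave_at n (N.succ (N.shiftr a s)) (N.shiftr b s) (N.succ (N.shiftr c s)).

(** With [t = 2^s], the outer entries lie below [t] times their rounded values and the middle one
    lies above; both sides of the tested inequality scale by [t^2]. *)
Lemma log_concave_testP (n a b c : N) : log_concave_test n a b c -> log_concave_at n a b c.
Proof.
rewrite /log_concave_test; set s := N.sub _ _; case: N.eqb => // /N.leb_le H.
apply/N.leb_le.
move: H; rewrite !N.shiftr_div_pow2.
have p0 : (2 ^ s <> 0)%num by apply: N.pow_nonzero.
have Ha := N.mul_succ_div_gt a _ p0.
have Hb := N.mul_div_le b _ p0.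
have Hc := N.mul_succ_div_gt c _ p0.
move: (N.div a _) (N.div b _) (N.div c _) Ha Hb Hc {p0}.
move: (N.pow 2 s) => t a' b' c' Ha Hb Hc H.
move: (N.mul n n) (N.pred _) H => u v H.
apply: (N.le_trans _ (u * ((t * N.succ a') * (t * N.succ c')))%num).
  by apply/N.mul_le_mono_l/N.mul_le_mono; apply: N.lt_le_incl.
apply: (N.le_trans _ (v * ((t * b') * (t * b')))%num); last first.
  by apply/N.mul_le_mono_l/N.mul_le_mono.
have -> : (u * ((t * N.succ a') * (t * N.succ c')) = t * t * (u * (N.succ a' * N.succ c')))%num by lia.
have -> : (v * ((t * b') * (t * b')) = t * t * (v * (b' * b')))%num by lia.
exact: N.mul_le_mono_l.
Qed.

Fixpoint log_concave_table (n : N) (l : seq N) : bool :=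
  match l with
  | a :: ((b :: c :: _) as l') => log_concave_test n a b c && log_concave_table (N.succ n) l'
  | _ => true
  end.

Lemma log_concave_tableP (n : N) (l : seq N) (i : nat) : log_concave_table n l -> i.+2 < size l ->
  log_concave_at (N.add n (N.of_nat i)) (nth 0%num l i) (nth 0%num l i.+1) (nth 0%num l i.+2).
Proof.
elim: i n l => [|i IH] n [|a [|b [|c l]]] //= /andP[Ht Hl] Hs.
  by rewrite N.add_0_r; apply: log_concave_testP.
have := IH (N.succ n) [:: b, c & l] Hl Hs.
by rewrite (_ : N.add (N.succ n) _ = N.add n (N.of_nat i.+1)) //; lia.
Qed.

Lemma log_concave_table_partition (m n : nat) : log_concave_table 32 (drop 31 (table m)) ->
  32 <= n < m ->
  n ^ 2 * (partition_count n.-1 * partition_count n.+1) <= (n ^ 2).-1 * partition_count n ^ 2.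
Proof.
move=> Ht Hn.
have Hs : (n - 32).+2 < size (drop 31 (table m)) by rewrite size_drop size_table; lia.
have := log_concave_tableP 32 _ _ Ht Hs.
rewrite !nth_drop => /N.leb_le.
(* Dropping 31 entries puts the left neighbour of the first case, [n = 32], at position 0. *)
have -> : 31 + (n - 32) = n.-1 by lia.
have -> : 31 + (n - 32).+1 = n by lia.
have -> : 31 + (n - 32).+2 = n.+1 by lia.
have -> : N.add 32 (N.of_nat (n - 32)) = N.of_nat n by lia.
by rewrite -!(@nth_table m); lia.
Qed.

Lemma log_concave_table_2000 : log_concave_table 32 (drop 31 (table 2000)).
Proof. by vm_cast_no_check (erefl true). Qed.

(** * Joining the analytic and the computed range *)

Lemma partition_rec_parts : partition_rec (fun K n => INR (parts K n)).
Proof.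
split=> [[|n] //|K n]; rewrite parts_rec plus_INR; congr (Rplus _ _).
by case: Nat.leb_spec => H; case: ltnP => H' //; lia.
Qed.

Lemma partition_count_log_concave_large (n : nat) : 2000 <= n ->
  n ^ 2 * (partition_count n.-1 * partition_count n.+1) <= (n ^ 2).-1 * partition_count n ^ 2.
Proof.
move=> Hn.
have Hn' : Peano.le 2000 n by exact/leP.
have := @partition_rec_log_concave _ n partition_rec_parts Hn' (fun m => pos_INR _).
(* The cut at [(n+1)^4] is at least [n+1], so the bound on the parts excludes no partition of [n-1],
   [n] or [n+1]. *)
have HK m : m <= n.+1 -> parts (Nat.pow (S n) 4) m = partition_count m.
  move=> Hm; rewrite partition_countE parts_stable //; apply: leq_trans Hm _.
  by apply/leP; rewrite -{1}(Nat.pow_1_r n.+1); apply: Nat.pow_le_mono_r; lia.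
rewrite !HK; try lia.
have -> : Nat.sub n 1 = n.-1 by lia.
have -> : Nat.add n 1 = n.+1 by lia.
move: (partition_count _) (partition_count _) (partition_count _) => a b c H.
apply/leP/INR_le; rewrite -!mulnn -subn1 -!multE -minusE !mult_INR minus_INR ?mult_INR; last first.
  by apply/leP; rewrite multE muln_gt0; lia.
move: H => /=; rewrite !Rmult_1_r => H; apply: Rle_trans H _; right; ring.
Qed.

Lemma partition_count_log_concave (n : nat) : 32 <= n ->
  n ^ 2 * (partition_count n.-1 * partition_count n.+1) <= (n ^ 2).-1 * partition_count n ^ 2.
Proof.
move=> Hn; have [H|H] := ltnP n 2000.
- by apply: log_concave_table_partition log_concave_table_2000 _; rewrite Hn.
- exact: partition_count_log_concave_large.
Qed.

Local Open Scope ring_scope.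

Theorem theorem6p1 (n : nat) : (32 <= n)%N -> q n.-1 * q n.+1 <= q n ^+ 2.
Proof.
move=> Hn; have := partition_count_log_concave n Hn; rewrite /q.
move: (partition_count _) (partition_count _) (partition_count _) => a b c H.
case: n Hn H => [//|n] Hn H.
have n0 : (0 < n)%N by lia.
rewrite mulf_div expr_div_n ler_pdivrMr ?mulr_gt0 ?ltr0n //.
rewrite mulrAC ler_pdivlMr ?exprn_gt0 ?ltr0n //.
rewrite -!natrM -!natrX -!natrM ler_nat.
(* After the shift of [n], this is the product of the denominators of the two outer terms. *)
have E : (n.+1 ^ 2).-1 = (n * n.+2)%N by lia.
by rewrite E in H; rewrite mulnC [leqRHS]mulnC.
Qed.
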